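(* Let $\overline{\mathbb D}=\{i,k\}$ be a two-state set ($i\neq k$). For every $\varepsilon\in(0,1]$ let $(\eta_{\varepsilon,n},\kappa_{\varepsilon,n})_{n\ge 0}$ be a Markov renewal process on $\mathbb X\times[0,\infty)$, and let $v_{\varepsilon,r}\in[1,\infty)$, $r\in\overline{\mathbb D}$, be normalisation functions. Assume: (A) $F_{\varepsilon,r}(0)<1$ for all $r\in\mathbb X$, $\varepsilon\in(0,1]$. (B) For every $r\in\overline{\mathbb D}$, $j\in\mathbb X$, either $p_{\varepsilon,rj}>0$ for all $\varepsilon\in(0,1]$ or $p_{\varepsilon,rj}=0$ for all $\varepsilon\in(0,1]$; and for every $r\in\overline{\mathbb D}$ there is a chain $r=j_0,j_1,\dots,j_n$ with $j_1,\dots,j_{n-1}\in\overline{\mathbb D}$, $j_n\in\mathbb D$ and $\prod_{l=1}^n p_{1,j_{l-1}j_l}>0$. (C) $p_{\varepsilon,rj}\to p_{0,rj}$ as $\varepsilon\to0$, for $r\in\overline{\mathbb D}$, $j\in\mathbb X$. (D) For $r\in\overline{\mathbb D}$, $j\in\mathbb Y_{1,r}$: $F_{\varepsilon,rj}(\cdot\, v_{\varepsilon,r})\Rightarrow F_{0,rj}(\cdot)$ as $\varepsilon\to0$, where $F_{0,rj}$ is a proper distribution function with $F_{0,rj}(0)<1$; and $v_{\varepsilon,r}\to v_{0,r}\in[1,\infty]$. (E) For $r\in\overline{\mathbb D}$, $j\in\mathbb Y_{1,r}$: $e_{\varepsilon,rj}<\infty$ for all $\varepsilon\in(0,1]$ and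 $e_{\varepsilon,rj}/v_{\varepsilon,r}\to e_{0,rj}=\int_0^\infty t\,F_{0,rj}(dt)<\infty$ as $\varepsilon\to0$. ($\tilde{\rm C}$) $\tilde p_{\varepsilon,rj}\to\tilde p_{0,rj}\in[0,1]$ as $\varepsilon\to0$, for $r\in\overline{\mathbb D}$, $j\in\mathbb X$. (${}_k\tilde{\rm C}$) ${}_k\tilde p_{\varepsilon,ij}\to{}_k\tilde p_{0,ij}\in[0,1]$ as $\varepsilon\to0$, for $j\in\mathbb X\setminus\{k\}$. (${}_k\hat{\rm C}$) ${}_k\hat q_{\varepsilon,ij}=\tilde p_{\varepsilon,ij}/{}_kp_{\varepsilon,ij}\to{}_k\hat q_{0,ij}\in[0,1]$ as $\varepsilon\to0$, for $j\in{}_k\mathbb Y_{1,i}$. (${}_k\hat{\rm F}$) $\tilde v_{\varepsilon,k}/\tilde v_{\varepsilon,i}\to\tilde w_{0,ki}\in[0,\infty)$ as $\varepsilon\to0$. Let ${}_k\tilde v_{\varepsilon,i}=(1-{}_kp_{\varepsilon,ii})^{-1}(1-p_{\varepsilon,ii})^{-1}v_{\varepsilon,i}$. Then for every $j\in\mathbb D$ $$G_{\varepsilon,\mathbb D,ij}(\cdot\;{}_k\tilde v_{\varepsilon,i})\Rightarrow G_{0,\mathbb D,ij}(\cdot)={}_k\tilde F_{0,ij}(\cdot)\;{}_k\tilde p_{0,ij}\quad\text{as }\varepsilon\to0,$$ where ${}_k\tilde F_{0,ij}$ is the distribution function with Laplace transform ${}_k\tilde\phi_{0,ij}$ given in the context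 for $j\in{}_k\tilde{\mathbb Y}_{1,i}$ (and $G_{0,\mathbb D,ij}\equiv0$ for $j\notin{}_k\tilde{\mathbb Y}_{1,i}$).
   Context: $\mathbb X=\{1,\dots,M\}$; $\mathbb D$ is a nonempty proper subset of $\mathbb X$ and $\overline{\mathbb D}=\mathbb X\setminus\mathbb D$. For each $\varepsilon\in(0,1]$, a Markov renewal process $(\eta_{\varepsilon,n},\kappa_{\varepsilon,n})_{n\ge0}$ is a homogeneous Markov chain on $\mathbb X\times[0,\infty)$ whose transition probabilities $Q_{\varepsilon,ij}(t)=\mathsf P\{\eta_{\varepsilon,1}=j,\kappa_{\varepsilon,1}\le t\mid\eta_{\varepsilon,0}=i,\kappa_{\varepsilon,0}=s\}$ do not depend on $s$. Notation: $p_{\varepsilon,ij}=Q_{\varepsilon,ij}(\infty)$; $F_{\varepsilon,i}(t)=\sum_{j}Q_{\varepsilon,ij}(t)$; $F_{\varepsilon,ij}=Q_{\varepsilon,ij}/p_{\varepsilon,ij}$ if $p_{\varepsilon,ij}>0$; $e_{\varepsilon,ij}=\int_0^\infty tF_{\varepsilon,ij}(dt)$; $\mathbb Y_{1,r}=\{j\in\mathbb X:p_{1,rj}>0\}$; $\phi_{0,rj}(s)=\int_0^\infty e^{-st}F_{0,rj}(dt)$. Hitting times: $\nu_{\varepsilon,\mathbb D}=\min(n\ge1:\eta_{\varepsilon,n}\in\mathbb D)$, $\tau_{\varepsilon,\mathbb D}=\sum_{n=1}^{\nu_{\varepsilon,\mathbb D}}\kappa_{\varepsilon,n}$, $G_{\varepsilon,\mathbb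 D,ij}(t)=\mathsf P\{\tau_{\varepsilon,\mathbb D}\le t,\ \eta_{\varepsilon,\nu_{\varepsilon,\mathbb D}}=j\mid\eta_{\varepsilon,0}=i\}$. Weak convergence $\Rightarrow$ of possibly improper distribution functions means convergence at continuity points of the limit together with convergence of total masses (equivalently, pointwise convergence of Laplace transforms for all $s\ge0$). Removing virtual transitions. For $r\in\overline{\mathbb D}$: $\tilde p_{\varepsilon,rj}=\mathrm I(j\ne r)\,p_{\varepsilon,rj}/(1-p_{\varepsilon,rr})$, $\tilde v_{\varepsilon,r}=(1-p_{\varepsilon,rr})^{-1}v_{\varepsilon,r}$, $\tilde{\mathbb Y}_{1,r}=\mathbb Y_{1,r}\setminus\{r\}$. For $j\in\tilde{\mathbb Y}_{1,r}$, $$\tilde\phi_{0,rj}(s)=\begin{cases}\phi_{0,rj}(s),& r\notin\mathbb Y_{1,r},\\ \frac{(1-p_{0,rr})\phi_{0,rj}((1-p_{0,rr})s)}{1-p_{0,rr}\phi_{0,rr}((1-p_{0,rr})s)},& r\in\mathbb Y_{1,r},\ p_{0,rr}<1,\\ (1+e_{0,rr}s)^{-1},&p_{0,rr}=1,\end{cases}\qquad \tilde e_{0,rj}=\begin{cases}e_{0,rj},& r\notin\mathbb Y_{1,r},\\(1-p_{0,rr})e_{0,rj}+p_{0,rr}e_{0,rr},& r\in\mathbb Y_{1,r}.\end{cases}$$ Excluding state $k$. For $j\in\mathbb X\setminus\{k\}$: ${}_kp_{\varepsilon,ij}=\tilde p_{\varepsilon,ij}+\tilde p_{\varepsilon,ik}\tilde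 p_{\varepsilon,kj}$ for $\varepsilon\in(0,1]$, with limits ${}_kp_{0,ij}=\tilde p_{0,ij}+\tilde p_{0,ik}\tilde p_{0,kj}$; ${}_k\mathbb Y_{1,i}=\{j\in\mathbb X\setminus\{k\}:{}_kp_{1,ij}>0\}$; ${}_k\tilde{\mathbb Y}_{1,i}={}_k\mathbb Y_{1,i}\setminus\{i\}$; ${}_k\tilde p_{\varepsilon,ij}=\mathrm I(j\ne i)\,{}_kp_{\varepsilon,ij}/(1-{}_kp_{\varepsilon,ii})$. (Condition (B) implies $p_{\varepsilon,rr}<1$ and ${}_kp_{\varepsilon,ii}<1$ for $\varepsilon\in(0,1]$.) For $j\in{}_k\mathbb Y_{1,i}$, $${}_k\phi_{0,ij}(s)=\begin{cases}\tilde\phi_{0,ij}(s)\,{}_k\hat q_{0,ij}+\tilde\phi_{0,ik}(s)\tilde\phi_{0,kj}(\tilde w_{0,ki}s)(1-{}_k\hat q_{0,ij}),& j,k\in\tilde{\mathbb Y}_{1,i},\ j\in\tilde{\mathbb Y}_{1,k},\\ \tilde\phi_{0,ij}(s),& j\in\tilde{\mathbb Y}_{1,i},\ \text{and } k\notin\tilde{\mathbb Y}_{1,i}\text{ or }j\notin\tilde{\mathbb Y}_{1,k},\\ \tilde\phi_{0,ik}(s)\tilde\phi_{0,kj}(\tilde w_{0,ki}s),& j\notin\tilde{\mathbb Y}_{1,i}\ (\text{in particular } j=i),\end{cases}$$ and, if $i\in{}_k\mathbb Y_{1,i}$, ${}_ke_{0,ii}=\tilde e_{0,ik}+\tilde w_{0,ki}\tilde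 e_{0,ki}$. Finally, for $j\in{}_k\tilde{\mathbb Y}_{1,i}$, $${}_k\tilde\phi_{0,ij}(s)=\begin{cases}{}_k\phi_{0,ij}(s),& i\notin{}_k\mathbb Y_{1,i},\\ \frac{(1-{}_kp_{0,ii})\,{}_k\phi_{0,ij}((1-{}_kp_{0,ii})s)}{1-{}_kp_{0,ii}\,{}_k\phi_{0,ii}((1-{}_kp_{0,ii})s)},& i\in{}_k\mathbb Y_{1,i},\ {}_kp_{0,ii}<1,\\ (1+{}_ke_{0,ii}s)^{-1},&{}_kp_{0,ii}=1.\end{cases}$$ *)

(* Defs.v *)
From HB Require Import structures.
From mathcomp Require Export all_boot all_order all_algebra.
From mathcomp Require Export all_classical all_reals all_analysis.
Set Implicit Arguments.
Unset Strict Implicit.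
Unset Printing Implicit Defensive.
Import Order.TTheory GRing.Theory Num.Theory.
Export numFieldNormedType.Exports.

Local Open Scope classical_set_scope.
Local Open Scope ring_scope.

(* Distributions on [0, oo[ are Borel measures on the real line that do not charge
the negative numbers; the associated distribution function is defined on the
whole line and vanishes on the negative numbers. *)

Notation Rmeasure R := {measure set (measurableTypeR R) -> \bar R}.
Notation Rprobability R := (probability (measurableTypeR R) R).

Definition on_half_line (R : realType) (mu : Rmeasure R) : Prop :=
  mu `]-oo, 0[%classic = 0%E.

Definition df (R : realType) (mu : Rmeasure R) (t : R) : R :=
  fine (mu `]-oo, t]%classic).

Definition mean (R : realType) (mu : Rmeasure R) : \bar R :=
  (\int[mu]_(t in `[0%R, +oo[) t%:E)%E.

Definition laplace (R : realType) (mu : Rmeasure R) (s : R) : R :=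
  \int[mu]_(t in `[0%R, +oo[) expR (- (s * t)).

Definition df_mass (R : realType) (F : R -> R) : R := lim (F t @[t --> +oo]).

(* Weak convergence, as e decreases to 0, of possibly improper distribution
functions. Continuity points are those of the functions on the whole line, so 0
counts as a continuity point only if the limit has no atom there. *)
Definition weak_cvg (R : realType) (F : R -> R -> R) (F0 : R -> R) : Prop :=
  (forall t : R, {for t, continuous F0} -> F e t @[e --> 0^'+] --> F0 t) /\
  df_mass (F e) @[e --> 0^'+] --> df_mass F0.

(* Q x y is the measure with distribution function t |-> Q_{xy}(t). *)
Definition semi_markov_kernel (R : realType) (M : nat)
    (Q : 'I_M -> 'I_M -> Rmeasure R) : Prop :=
  (forall x y, on_half_line (Q x y)) /\
  (forall x, (\sum_(y < M) Q x y setT = 1)%E).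

Section markov_renewal.
Context (R : realType) (M : nat) (d : measure_display) (T : measurableType d).
Variables (P : probability T R) (eta : nat -> T -> 'I_M) (kappa : nat -> T -> R).

Definition history (n : nat) : set (set T) :=
  <<s [set A | exists l : nat, (l <= n)%N /\
        ((exists x, A = eta l @^-1` [set x]) \/
         (exists B : set (measurableTypeR R),
            measurable B /\ A = kappa l @^-1` B))] >>.

(* The Markov property says that, given the history up to time n, the event
{eta_{n+1} = y, kappa_{n+1} <= t} has conditional probability Q_{eta_n y}(t);
as the state space is finite, this is expressed on each event {eta_n = x}. *)
Definition markov_renewal (Q : 'I_M -> 'I_M -> Rmeasure R) : Prop :=
  [/\ semi_markov_kernel Q,
      forall n x, measurable (eta n @^-1` [set x]),
      forall n, measurable_fun setT (kappa n : T -> measurableTypeR R),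
      forall n w, 0 <= kappa n w &
      forall n A x y t, history n A ->
        P (A `&` [set w | eta n w = x] `&`
             [set w | eta n.+1 w = y /\ kappa n.+1 w <= t]) =
        (P (A `&` [set w | eta n w = x]) * Q x y `]-oo, t]%classic)%E].

Definition cond_prob (A B : set T) : R := fine (P (A `&` B)) / fine (P B).

Variable D : {set 'I_M}.

(* [None] stands for an infinite hitting index. *)
Definition hit_index (w : T) : option nat :=
  match pselect (exists n, (1 <= n)%N && (eta n w \in D)) with
  | left h => Some (ex_minn h)
  | right _ => None
  end.

Definition hit_time (w : T) : \bar R :=
  if hit_index w is Some n then (\sum_(1 <= l < n.+1) kappa l w)%:E else +oo%E.

Definition hit_df (i j : 'I_M) (t : R) : R :=
  cond_prob
    [set w | (hit_time w <= t%:E)%E /\ omap (eta^~ w) (hit_index w) = Some j]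
    [set w | eta 0%N w = i].

End markov_renewal.

Definition trans_prob (R : realType) (M : nat)
    (Q : 'I_M -> 'I_M -> Rmeasure R) (x y : 'I_M) : R :=
  fine (Q x y setT).

(* Q_{xy} / p_{xy} when p_{xy} > 0, and an irrelevant Dirac mass otherwise. *)
Definition sojourn (R : realType) (M : nat)
    (Q : 'I_M -> 'I_M -> Rmeasure R) (x y : 'I_M) : Rprobability R :=
  mnormalize (Q x y) (dirac (0 : measurableTypeR R)).

Definition targets (R : realType) (M : nat) (p : 'I_M -> 'I_M -> R)
    (r : 'I_M) : {set 'I_M} :=
  finset (fun j => 0 < p r j).

(* The matrix obtained from p by removing virtual transitions r -> r. *)
Definition no_virtual (R : realType) (M : nat) (p : 'I_M -> 'I_M -> R)
    (r j : 'I_M) : R :=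
  (j != r)%:R * (p r j / (1 - p r r)).

(* One-step probabilities i -> j after exclusion of the state k, from
probabilities pt without virtual transitions; meant for j != k. *)
Definition exclude (R : realType) (M : nat) (k : 'I_M)
    (pt : 'I_M -> 'I_M -> R) (i j : 'I_M) : R :=
  pt i j + pt i k * pt k j.

(* Limiting Laplace transform, after removal of virtual transitions, of the time
of a transition r -> j: [loop] tells whether r -> r is possible, [p] is the
limiting probability of r -> r, [e] and [phir] are the limiting mean and Laplace
transform of its duration, [phij] is the one for r -> j. In the last case p = 1. *)
Definition no_virtual_laplace (R : realType) (loop : bool) (p e : R)
    (phir phij : R -> R) (s : R) : R :=
  if ~~ loop then phij s
  else if p < 1 then
    (1 - p) * phij ((1 - p) * s) / (1 - p * phir ((1 - p) * s))
  else (1 + e * s)^-1.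

Section limits.
Context (R : realType) (M : nat).
Variables (p1 p0 : 'I_M -> 'I_M -> R) (F0 : 'I_M -> 'I_M -> Rprobability R).

Definition phit0 (r j : 'I_M) : R -> R :=
  no_virtual_laplace (r \in targets p1 r) (p0 r r) (fine (mean (F0 r r)))
    (laplace (F0 r r)) (laplace (F0 r j)).

Definition et0 (r j : 'I_M) : R :=
  if r \notin targets p1 r then fine (mean (F0 r j))
  else (1 - p0 r r) * fine (mean (F0 r j)) + p0 r r * fine (mean (F0 r r)).

Definition targets_t (r : 'I_M) : {set 'I_M} := targets p1 r :\ r.

Variables (i k : 'I_M).

Definition ktargets : {set 'I_M} :=
  targets (exclude k (no_virtual p1)) i :\ k.

Definition ktargets_t : {set 'I_M} := ktargets :\ i.

Variables (pt0 : 'I_M -> 'I_M -> R) (q0 : 'I_M -> R) (w0 : R).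

Definition kphi0 (j : 'I_M) (s : R) : R :=
  if j \in targets_t i then
    if (k \in targets_t i) && (j \in targets_t k) then
      phit0 i j s * q0 j + phit0 i k s * phit0 k j (w0 * s) * (1 - q0 j)
    else phit0 i j s
  else phit0 i k s * phit0 k j (w0 * s).

Definition ke0 : R := et0 i k + w0 * et0 k i.

Definition kphit0 (j : 'I_M) : R -> R :=
  no_virtual_laplace (i \in ktargets) (exclude k pt0 i i) ke0
    (kphi0 i) (kphi0 j).

End limits.

(* Main.v *)
(* The Laplace transform of the hitting time solves a 2x2 linear system indexed by
the two transient states, and its solution can be regrouped as the successive
removals of the virtual transitions, of the state k, and of the virtual
transitions created by that removal. Each of these operations acts on families of
Laplace transforms and preserves convergence together with convergence of the
first moments; the latter is what identifies the limit when the probability of a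
loop tends to 1, where only a rescaled neighbourhood of 0 of the transforms
matters. The continuity theorem for Laplace transforms on the half line then
translates back and forth between transforms and weak convergence. *)
From HB Require Import structures.
Require Import Defs.
From mathcomp Require Import measurable_realfun ring lra.
Set Implicit Arguments.
Unset Strict Implicit.
Unset Printing Implicit Defensive.
Import Order.TTheory GRing.Theory Num.Theory.

Local Open Scope classical_set_scope.
Local Open Scope ring_scope.

(** * Convergent families of Laplace transforms *)

(** The arguments of the transforms move with the parameter: they carry factors such as [1 - p e] or
    a ratio of normalisations, which may tend to 0. Convergence at fixed arguments does not compose
    under such rescalings, so a family is asked to converge along every convergent choice of
    arguments; the finite means supply the Lipschitz bounds for this. A loop probability tending to
    1 produces a quotient of the form 0/0. Dividing numerator and denominator by [1 - p e] leaves a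
    difference quotient of the loop transform at a vanishing argument, whose limit is a first
    moment; this is why the step [dl] is left free in the third clause. The intermediate families
    are treated as mere functions: only the original sojourn laws and the final hitting law are
    measures. The limit is an explicit formula, not known beforehand to be a transform, so its law
    has to be constructed; the bound [1 - m * s <= f0 s] carried by every family keeps mass from
    escaping to infinity. *)

Section laplace_families.
Context (R : realType) (I : Type) (F : set_system I) {FF : ProperFilter F}.

(* The third clause is convergence of the first moments to [m], expressed on the
transforms; it is what decides the limit when a loop becomes absorbing. *)
Definition cvg_family (f : I -> R -> R) (f0 : R -> R) (m : R) : Prop :=
  [/\ \forall e \near F, forall s, 0 <= s -> 0 <= f e s <= 1,
      forall (u : I -> R) (u0 : R), (\forall e \near F, 0 <= u e) ->
        u @ F --> u0 -> f e (u e) @[e --> F] --> f0 u0,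
      forall (u dl : I -> R) (u0 : R), (\forall e \near F, 0 <= u e) ->
        u @ F --> u0 -> (\forall e \near F, 0 < dl e) -> dl @ F --> (0 : R) ->
        (1 - f e (dl e * u e)) / dl e @[e --> F] --> m * u0 &
      0 <= m /\
      forall s, 0 <= s -> [/\ 0 <= f0 s, f0 s <= 1 & 1 - m * s <= f0 s]].

Lemma cvg_family_at f f0 m s : cvg_family f f0 m -> 0 <= s ->
  f e s @[e --> F] --> f0 s.
Proof.
by case=> _ + _ _ s0; apply; [exact: nearW|exact: cvg_cst].
Qed.

Lemma eq_cvg_family (f g : I -> R -> R) (f0 g0 : R -> R) m :
  (\forall e \near F, forall s, 0 <= s -> f e s = g e s) ->
  (forall s, 0 <= s -> f0 s = g0 s) ->
  cvg_family f f0 m -> cvg_family g g0 m.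
Proof.
move=> fg fg0 [f1 f2 f3 [m0 f4]]; split.
- by near=> e => s s0; rewrite -(near fg e)//; exact: (near f1 e).
- move=> u u0 u_ge0 uu0; rewrite -fg0.
    apply: cvg_trans (f2 u u0 u_ge0 uu0); apply: near_eq_cvg.
    by near=> e; apply: (near fg e) => //; exact: (near u_ge0 e).
  exact: cvgr_to_ge uu0 _.
- move=> u dl u0 u_ge0 uu0 dl_gt0 dl0.
  apply: cvg_trans (f3 u dl u0 u_ge0 uu0 dl_gt0 dl0); apply: near_eq_cvg.
  near=> e; rewrite (near fg e)// mulr_ge0//; first exact/ltW/(near dl_gt0 e).
  exact: (near u_ge0 e).
- by split=> // s s0; rewrite -fg0//; exact: f4.
Unshelve. all: by end_near. Qed.

(** A change of clock: durations of transitions out of [k] come in units of [vt e k], and the ratio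
    to the unit [vt e i] enters as [w]. The value [w0 = 0] is allowed and makes the limit constant,
    equal to 1. *)
Lemma cvg_family_scale f f0 m (w : I -> R) (w0 : R) :
  (\forall e \near F, 0 <= w e) -> w @ F --> w0 -> 0 <= w0 ->
  cvg_family f f0 m ->
  cvg_family (fun e s => f e (w e * s)) (fun s => f0 (w0 * s)) (w0 * m).
Proof.
move=> w_ge0 ww0 w0_ge0 [f1 f2 f3 [m0 f4]]; split.
- near=> e => s s0; apply: (near f1 e) => //.
  by rewrite mulr_ge0//; exact: (near w_ge0 e).
- move=> u u0 u_ge0 uu0; apply: f2; last exact: cvgM.
  by near=> e; rewrite mulr_ge0//; near: e.
- move=> u dl u0 u_ge0 uu0 dl_gt0 dl0.
  rewrite -mulrA mulrCA.
  under eq_fun do rewrite mulrCA.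
  apply: f3 => //; last exact: cvgM.
  by near=> e; rewrite mulr_ge0//; near: e.
- split; first exact: mulr_ge0.
  move=> s s0; have [] := f4 (w0 * s); first exact: mulr_ge0.
  by move=> -> -> h; split=> //; rewrite -mulrA mulrCA.
Unshelve. all: by end_near. Qed.

Lemma cvg_family_mul f g f0 g0 m m' :
  cvg_family f f0 m -> cvg_family g g0 m' ->
  cvg_family (fun e s => f e s * g e s) (fun s => f0 s * g0 s) (m + m').
Proof.
move=> [f1 f2 f3 [m0 f4]] [g1 g2 g3 [m'0 g4]]; split.
- near=> e => s s0.
  have /andP[fa fb] : 0 <= f e s <= 1 by apply: (near f1 e).
  have /andP[ga gb] : 0 <= g e s <= 1 by apply: (near g1 e).
  by rewrite mulr_ge0// mulr_ile1.
- by move=> u u0 u_ge0 uu0; apply: cvgM; [exact: f2|exact: g2].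
- move=> u dl u0 u_ge0 uu0 dl_gt0 dl0.
  (* This is 1 - f g = (1 - f) + f (1 - g); the extra factor f tends to [f0 0], which the fourth
     clause at s = 0 forces to be 1. *)
  have -> : (fun e => (1 - f e (dl e * u e) * g e (dl e * u e)) / dl e) =
      (fun e => (1 - f e (dl e * u e)) / dl e +
         f e (dl e * u e) * ((1 - g e (dl e * u e)) / dl e)).
    by apply/funext => e; ring.
  have -> : (m + m') * u0 = m * u0 + f0 (0 * u0) * (m' * u0).
    rewrite mul0r; have [_ a1] := f4 0 (lexx _).
    rewrite mulr0 subr0 => a2.
    have -> : f0 0 = 1 by apply/eqP; rewrite eq_le a1 a2.
    by ring.
  apply: cvgD; first exact: f3.
  apply: cvgM; last exact: g3.
  apply: f2; last exact: cvgM.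
  by near=> e; rewrite mulr_ge0//; [apply/ltW|]; near: e.
- split; first exact: addr_ge0.
  move=> s s0; have [a1 a2 a3] := f4 s s0; have [b1 b2 b3] := g4 s s0.
  by split; [exact: mulr_ge0|exact: mulr_ile1|nra].
Unshelve. all: by end_near. Qed.

Lemma cvg_family_mix f g f0 g0 m m' (q : I -> R) (q0 : R) :
  (\forall e \near F, 0 <= q e <= 1) -> q @ F --> q0 -> 0 <= q0 <= 1 ->
  cvg_family f f0 m -> cvg_family g g0 m' ->
  cvg_family (fun e s => f e s * q e + g e s * (1 - q e))
    (fun s => f0 s * q0 + g0 s * (1 - q0)) (m * q0 + m' * (1 - q0)).
Proof.
move=> q01 qq0 /andP[q0a q0b] [f1 f2 f3 [m0 f4]] [g1 g2 g3 [m'0 g4]].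
have q1 : 1 - q e @[e --> F] --> 1 - q0 by apply: cvgB => //; exact: cvg_cst.
split.
- near=> e => s s0.
  have /andP[fa fb] : 0 <= f e s <= 1 by apply: (near f1 e).
  have /andP[ga gb] : 0 <= g e s <= 1 by apply: (near g1 e).
  have /andP[qa qb] : 0 <= q e <= 1 by near: e.
  by apply/andP; split; nra.
- move=> u u0 u_ge0 uu0.
  by apply: cvgD; apply: cvgM => //; [exact: f2|exact: g2].
- move=> u dl u0 u_ge0 uu0 dl_gt0 dl0.
  have -> : (fun e => (1 - (f e (dl e * u e) * q e + g e (dl e * u e) * (1 - q e)))
                / dl e) =
      (fun e => (1 - f e (dl e * u e)) / dl e * q e +
         (1 - g e (dl e * u e)) / dl e * (1 - q e)).
    by apply/funext => e; ring.
  have -> : (m * q0 + m' * (1 - q0)) * u0 = m * u0 * q0 + m' * u0 * (1 - q0).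
    by ring.
  by apply: cvgD; apply: cvgM => //; [exact: f3|exact: g3].
- split; first by rewrite addr_ge0// mulr_ge0// subr_ge0.
  move=> s s0; have [a1 a2 a3] := f4 s s0; have [b1 b2 b3] := g4 s s0.
  by split; nra.
Unshelve. all: by end_near. Qed.

(** The quotient is the transform of a geometric number of loops [f] followed by an exit [g], with
    time rescaled by the exit probability. The mean number of loops is p / (1 - p), which after
    rescaling gives the weights [1 - p0] and [p0] of the two moments. *)
Lemma cvg_family_no_virtual f g f0 g0 m m' (p : I -> R) (p0 : R) :
  (\forall e \near F, 0 <= p e < 1) -> p @ F --> p0 ->
  cvg_family f f0 m -> cvg_family g g0 m' ->
  cvg_family
    (fun e s => (1 - p e) * g e ((1 - p e) * s) / (1 - p e * f e ((1 - p e) * s)))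
    (no_virtual_laplace true p0 m f0 g0) ((1 - p0) * m' + p0 * m).
Proof.
move=> p01 pp0 [f1 f2 f3 [m0 f4]] [g1 g2 g3 [m'0 g4]].
have p0_ge0 : 0 <= p0.
  by apply: cvgr_to_ge pp0 _; near=> e; have /andP[] : 0 <= p e < 1 by near: e.
have p0_le1 : p0 <= 1.
  apply: cvgr_to_le pp0 _; near=> e.
  by have /andP[_ /ltW] : 0 <= p e < 1 by near: e.
have q1 : 1 - p e @[e --> F] --> 1 - p0 by apply: cvgB => //; exact: cvg_cst.
have q_gt0 : \forall e \near F, 0 < 1 - p e.
  by near=> e; rewrite subr_gt0; have /andP[] : 0 <= p e < 1 by near: e.
have f00 : f0 0 = 1.
  by have [_ a1] := f4 0 (lexx _); rewrite mulr0 subr0 => a2;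
    apply/eqP; rewrite eq_le a1 a2.
have g00 : g0 0 = 1.
  by have [_ a1] := g4 0 (lexx _); rewrite mulr0 subr0 => a2;
    apply/eqP; rewrite eq_le a1 a2.
split.
- near=> e => s s0.
  have /andP[pa pb] : 0 <= p e < 1 by near: e.
  have s'0 : 0 <= (1 - p e) * s by rewrite mulr_ge0// subr_ge0 ltW.
  have /andP[fa fb] : 0 <= f e ((1 - p e) * s) <= 1 by apply: (near f1 e).
  have /andP[ga gb] : 0 <= g e ((1 - p e) * s) <= 1 by apply: (near g1 e).
  have d0 : 0 < 1 - p e * f e ((1 - p e) * s) by nra.
  rewrite ler_pdivrMr// mul1r divr_ge0 ?(ltW d0)//=; first by nra.
  by rewrite mulr_ge0// subr_ge0 ltW.
- move=> u u0 u_ge0 uu0.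
  have u0_ge0 : 0 <= u0 by exact: cvgr_to_ge uu0 _.
  have qu_ge0 : \forall e \near F, 0 <= (1 - p e) * u e.
    near=> e; rewrite mulr_ge0//; last by near: e.
    by apply: ltW; near: e.
  have quu0 : (1 - p e) * u e @[e --> F] --> (1 - p0) * u0 by exact: cvgM.
  rewrite /no_virtual_laplace /=; case: ltP => [p0_lt1|p0_ge1].
    apply: cvgM; first by apply: cvgM => //; exact: g2.
    apply: cvgV.
      have s'0 : 0 <= (1 - p0) * u0 by rewrite mulr_ge0// subr_ge0.
      have [] := f4 _ s'0; move: (f0 _) => x x0 x1 _.
      by rewrite gt_eqF//; nra.
    by apply: cvgB; [exact: cvg_cst|apply: cvgM => //; exact: f2].
  have p0E : p0 = 1 by apply/eqP; rewrite eq_le p0_le1.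
  have -> : (1 + m * u0)^-1 = g0 ((1 - p0) * u0) * (1 + p0 * (m * u0))^-1.
    by rewrite p0E subrr mul0r g00 !mul1r.
  (* After division by [1 - p e] the denominator is 1 plus [p e] times a difference quotient of [f]
     with step [dl = 1 - p e]. As this step tends to 0, the third clause gives its limit. *)
  apply: (@cvg_trans _ ((fun e => g e ((1 - p e) * u e) *
     (1 + p e * ((1 - f e ((1 - p e) * u e)) / (1 - p e)))^-1) @ F)).
    apply: near_eq_cvg; near=> e.
    have /andP[pa pb] : 0 <= p e < 1 by near: e.
    have s'0 : 0 <= (1 - p e) * u e by near: e.
    have /andP[fa fb] : 0 <= f e ((1 - p e) * u e) <= 1 by apply: (near f1 e).
    have q0 : 0 < 1 - p e by near: e.
    have d0 : 0 < 1 - p e * f e ((1 - p e) * u e) by nra.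
    have -> : 1 + p e * ((1 - f e ((1 - p e) * u e)) / (1 - p e)) =
              (1 - p e * f e ((1 - p e) * u e)) / (1 - p e).
      by field; rewrite gt_eqF.
    by field; rewrite !gt_eqF.
  apply: cvgM; first exact: g2.
  apply: cvgV; first by rewrite gt_eqF// p0E mul1r ltr_pwDl// mulr_ge0.
  apply: cvgD; first exact: cvg_cst.
  apply: cvgM => //; apply: f3 => //.
  by move: q1; rewrite p0E subrr.
- move=> u dl u0 u_ge0 uu0 dl_gt0 dl0.
  have dq_gt0 : \forall e \near F, 0 < (1 - p e) * dl e.
    by near=> e; rewrite mulr_gt0//; near: e.
  have dq0 : (1 - p e) * dl e @[e --> F] --> (0 : R).
    by rewrite -[X in _ --> X](mulr0 (1 - p0)); exact: cvgM.
  (* The step [(1 - p e) * dl e] tends to 0 whatever [p0] is, so one computation covers both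
     [p0 < 1] and [p0 = 1]. *)
  pose fr e := (1 - f e ((1 - p e) * dl e * u e)) / ((1 - p e) * dl e).
  pose gr e := (1 - g e ((1 - p e) * dl e * u e)) / ((1 - p e) * dl e).
  have frc : fr e @[e --> F] --> m * u0 by exact: f3.
  have grc : gr e @[e --> F] --> m' * u0 by exact: g3.
  have -> : ((1 - p0) * m' + p0 * m) * u0 =
     (p0 * (m * u0) + (1 - p0) * (m' * u0)) * (1 + p0 * (0 * (m * u0)))^-1.
    by field.
  apply: (@cvg_trans _ ((fun e => (p e * fr e + (1 - p e) * gr e) *
     (1 + p e * (dl e * fr e))^-1) @ F)).
    apply: near_eq_cvg; near=> e.
    have /andP[pa pb] : 0 <= p e < 1 by near: e.
    have dle : 0 < dl e by near: e.
    have q0 : 0 < 1 - p e by near: e.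
    have ue : 0 <= u e by near: e.
    have s'0 : 0 <= (1 - p e) * dl e * u e.
      by rewrite mulr_ge0// mulr_ge0// ltW.
    have : 0 <= f e ((1 - p e) * dl e * u e) <= 1 by apply: (near f1 e).
    rewrite /fr /gr [(1 - p e) * (dl e * u e)]mulrA.
    move: (f e _) (g e _) => x y /andP[x0 x1].
    have d0 : 0 < 1 - p e * x by nra.
    have -> : 1 + p e * (dl e * ((1 - x) / ((1 - p e) * dl e))) =
              (1 - p e * x) / (1 - p e).
      by field; rewrite !gt_eqF.
    by field; rewrite !gt_eqF.
  apply: cvgM; first by apply: cvgD; exact: cvgM.
  apply: cvgV; first by rewrite mul0r mulr0 addr0 oner_eq0.
  by apply: cvgD; [exact: cvg_cst|apply: cvgM => //; exact: cvgM].
- split; first by rewrite addr_ge0// mulr_ge0// subr_ge0.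
  move=> s s0; rewrite /no_virtual_laplace /=; case: ltP => [p0_lt1|p0_ge1].
    have s'0 : 0 <= (1 - p0) * s by rewrite mulr_ge0// subr_ge0 ltW.
    have [] := f4 _ s'0; have [] := g4 _ s'0.
    move: (f0 _) (g0 _) => x y y0 y1 ym x0 x1 xm.
    have d0 : 0 < 1 - p0 * x by nra.
    split.
    + by rewrite divr_ge0 ?(ltW d0)// mulr_ge0// subr_ge0.
    + by rewrite ler_pdivrMr// mul1r; nra.
    + rewrite -subr_ge0.
      (* The defect from 1 is (p0 (1 - x) + (1 - p0) (1 - y)) / (1 - p0 x). Both 1 - x and 1 - y are
         at most a moment times (1 - p0) s, and this factor 1 - p0 cancels against 1 - p0 x >= 1 -
         p0. *)
      have -> : (1 - p0) * y / (1 - p0 * x) - (1 - ((1 - p0) * m' + p0 * m) * s) =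
        (((1 - p0) * m' + p0 * m) * s * (1 - p0 * x)
           - (p0 * (1 - x) + (1 - p0) * (1 - y))) / (1 - p0 * x).
        by field; rewrite gt_eqF.
      rewrite divr_ge0 ?(ltW d0)// subr_ge0.
      apply: (@le_trans _ _ (((1 - p0) * m' + p0 * m) * s * (1 - p0))).
        have -> : ((1 - p0) * m' + p0 * m) * s * (1 - p0) =
           p0 * (m * ((1 - p0) * s)) + (1 - p0) * (m' * ((1 - p0) * s)) by ring.
        by rewrite lerD// ler_wpM2l//; lra.
      rewrite ler_wpM2l//; last by nra.
      by rewrite mulr_ge0// addr_ge0// mulr_ge0// subr_ge0.
  have p0E : p0 = 1 by apply/eqP; rewrite eq_le p0_le1.
  have d0 : 0 < 1 + m * s by rewrite ltr_pwDl// mulr_ge0.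
  rewrite p0E subrr mul0r add0r mul1r; split.
  + by rewrite invr_ge0 ltW.
  + by rewrite invf_le1// lerDl mulr_ge0.
  + rewrite -[(1 + _)^-1]mul1r ler_pdivlMr//.
    have : 0 <= m * s by rewrite mulr_ge0.
    by move: (m * s) => z; nra.
Unshelve. all: by end_near. Qed.

End laplace_families.

(** * Laplace transforms of distributions on the half line *)

Section exponential_bounds.
Context (R : realType).
Implicit Types x y : R.

Lemma expRN_ge0_le1 x : 0 <= x -> 0 <= expR (- x) <= 1.
Proof. by move=> x0; rewrite expR_ge0 -expR0 ler_expR oppr_le0. Qed.

Lemma one_sub_expRN_le x : 1 - expR (- x) <= x.
Proof. by have := expR_ge1Dx (- x); lra. Qed.

Lemma one_sub_expRN_ge x : 0 <= x -> x / (1 + x) <= 1 - expR (- x).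
Proof.
move=> x0; have h := expR_ge1Dx x; have d0 : 0 < 1 + x by lra.
have -> : x / (1 + x) = 1 - (1 + x)^-1 by field; rewrite gt_eqF.
by rewrite lerD2l lerN2 expRN lef_pV2// posrE expR_gt0.
Qed.

Lemma expRN_lipschitz x y : 0 <= x -> 0 <= y ->
  `|expR (- x) - expR (- y)| <= `|x - y|.
Proof.
wlog xy : x y / x <= y => [th x0 y0|x0 y0].
  have [xy|yx] := leP x y; first exact: th.
  by rewrite distrC (distrC x); apply: th => //; exact: ltW.
rewrite distrC (distrC x) ler0_norm; last by rewrite subr_le0 ler_expR lerN2.
rewrite ger0_norm ?subr_ge0// opprB.
have -> : - y = - x + - (y - x) by ring.
rewrite expRD.
have /andP[a0 a1] := expRN_ge0_le1 x0.
have b := one_sub_expRN_le (y - x).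
have yx0 : 0 <= y - x by rewrite subr_ge0.
have /andP[c0 c1] := expRN_ge0_le1 yx0.
by move: (expR (- (y - x))) (expR (- x)) a0 a1 b c0 c1 => ? ?; nra.
Qed.

(* Convexity of the exponential, read off from its tangent at [- x]. *)
Lemma one_sub_expRN_ratio x y : 0 <= x -> x <= y ->
  x * (1 - expR (- y)) <= y * (1 - expR (- x)).
Proof.
move=> x0 xy; have h1 := expR_ge1Dx x.
have h2 := expR_ge1Dx (- (y - x)).
have -> : - y = - x + - (y - x) by ring.
rewrite expRD.
have h3 : expR (- x) * expR x = 1 by rewrite -expRD addNr expR0.
have b0 := expR_gt0 (- x); set b := expR (- x) in h3 b0 *.
set a := expR _ in h2 *; set c := expR _ in h1 h3.
have h4 : b * (1 + x) <= 1 by rewrite -[leRHS]h3 ler_pM2l.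
have h5 : b * (1 - (y - x)) <= b * a by rewrite ler_pM2l.
have : x * (b * (1 - (y - x))) <= x * (b * a) by exact: ler_wpM2l.
have : (y - x) * (b * (1 + x)) <= (y - x) * 1 by rewrite ler_wpM2l// subr_ge0.
by nra.
Qed.

End exponential_bounds.

Section half_line_integrals.
Context (R : realType) (mu : Rprobability R).
Hypothesis mu0 : on_half_line mu.
Local Notation H := (`[0%R, +oo[%classic : set (measurableTypeR R)).

Lemma half_line_mass : mu H = 1%E.
Proof.
rewrite -(@probability_setT _ _ _ mu) -(setUv H) measureU//; last first.
- by rewrite setICr.
- exact: measurableC.
rewrite setCitvr -[LHS]adde0; congr (_ + _)%E; exact/esym.
Qed.

Lemma half_line_bounded_integrable (f : R -> R) (M : R) :
  measurable_fun setT f -> (forall t, 0 <= t -> `|f t| <= M) ->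
  mu.-integrable H (EFin \o f).
Proof.
move=> mf fM; apply: measurable_bounded_integrable => //.
- by rewrite ltey_eq fin_num_measure.
- exact: measurable_funTS.
- exists M; split; first exact: num_real.
  move=> N MN t /=; rewrite in_itv/= andbT => t0.
  by rewrite (le_trans (fM _ t0))// ltW.
Qed.

Lemma half_line_integral_cst (c : R) : \int[mu]_(t in H) c = c.
Proof. by rewrite Rintegral_cst// [X in fine X](half_line_mass) mulr1. Qed.

Lemma df_half_line (t : R) : t < 0 -> df mu t = 0.
Proof.
move=> t0; rewrite /df [X in fine X](_ : _ = 0%E)//; apply/eqP.
rewrite eq_le measure_ge0 andbT -mu0; apply: le_measure; rewrite ?inE//.
by move=> x /=; rewrite !in_itv/= => /le_lt_trans; exact.
Qed.

Lemma half_line_integral_indic (y : R) :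
  \int[mu]_(t in H) (\1_(`]-oo, y]%classic) t) = df mu y.
Proof.
rewrite /Rintegral integral_indic//= /df; congr fine.
rewrite [RHS](measureDI mu (B := H))//= [X in (X + _)%E](_ : _ = 0%E) ?add0e//.
apply/eqP; rewrite eq_le measure_ge0 andbT -mu0; apply: le_measure.
- by rewrite inE; exact: measurableD.
- by rewrite inE.
- by move=> x /= []; rewrite !in_itv/= andbT => _ /negP; rewrite -ltNge.
Qed.

Lemma df_ge0_le1 (t : R) : 0 <= df mu t <= 1.
Proof.
rewrite fine_ge0//= /df -lee_fin fineK ?fin_num_measure//.
exact: probability_le1.
Qed.

Lemma df_homo : {homo df mu : s t / s <= t}.
Proof.
move=> s t st; rewrite fine_le ?fin_num_measure//.
by apply: le_measure; rewrite ?inE//; exact: subset_itvl.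
Qed.

Lemma half_line_mean_integrable : (mean mu < +oo)%E ->
  mu.-integrable H (EFin \o id).
Proof.
move=> h; apply/integrableP; split.
  by apply/measurable_EFinP; exact: measurable_funTS.
move: h; rewrite /mean; congr (_ < _)%E; apply: eq_integral => t.
by rewrite inE/= in_itv/= andbT => t0; rewrite ger0_norm.
Qed.

Lemma fine_mean_ge0 : 0 <= fine (mean mu).
Proof.
apply: fine_ge0; apply: integral_ge0 => t /=; rewrite in_itv/= andbT.
by rewrite lee_fin.
Qed.

Lemma measurable_expRN (s : R) : measurable_fun setT (fun t : R => expR (- (s * t))).
Proof.
apply: measurableT_comp => //; apply: measurableT_comp => //.
Qed.

Lemma expRN_integrable (s : R) : 0 <= s ->
  mu.-integrable H (EFin \o (fun t => expR (- (s * t)))).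
Proof.
move=> s0; apply: (@half_line_bounded_integrable _ 1).
  exact: measurable_expRN.
move=> t t0; have st0 : 0 <= s * t by exact: mulr_ge0.
by have /andP[a0 a1] := expRN_ge0_le1 st0; rewrite ger0_norm.
Qed.

Lemma laplace_ge0_le1 (s : R) : 0 <= s -> 0 <= laplace mu s <= 1.
Proof.
move=> s0; apply/andP; split.
  by apply: Rintegral_ge0 => t _; exact: expR_ge0.
rewrite -[leRHS]half_line_integral_cst; apply: le_Rintegral => //.
- exact: expRN_integrable.
- by apply: (@half_line_bounded_integrable _ 1) => // t _; rewrite normr1.
- move=> t /=; rewrite in_itv/= andbT => t0.
  by have /andP[] := expRN_ge0_le1 (mulr_ge0 s0 t0).
Qed.

Lemma laplace0 : laplace mu 0 = 1.
Proof.
rewrite -[RHS]half_line_integral_cst; apply: eq_Rintegral => t _.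
by rewrite mul0r oppr0 expR0.
Qed.

Lemma one_sub_laplace (s : R) : 0 <= s ->
  1 - laplace mu s = \int[mu]_(t in H) (1 - expR (- (s * t))).
Proof.
move=> s0; rewrite RintegralB//; first by rewrite half_line_integral_cst.
- by apply: (@half_line_bounded_integrable _ 1) => // t _; rewrite normr1.
- exact: expRN_integrable.
Qed.

Lemma one_sub_expRN_integrable (s : R) : 0 <= s ->
  mu.-integrable H (EFin \o (fun t => 1 - expR (- (s * t)))).
Proof.
move=> s0; apply: (@half_line_bounded_integrable _ 1).
  by apply: measurable_funB => //; exact: measurable_expRN.
move=> t t0; have /andP[a0 a1] := expRN_ge0_le1 (mulr_ge0 s0 t0).
by rewrite ger0_norm ?subr_ge0//; lra.
Qed.

(** The mean as Lipschitz constant carries convergence at a fixed argument over to moving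
    arguments. *)
Lemma laplace_lipschitz (s s' : R) : (mean mu < +oo)%E -> 0 <= s -> 0 <= s' ->
  `|laplace mu s - laplace mu s'| <= `|s - s'| * fine (mean mu).
Proof.
move=> hm s0 s'0; have im := half_line_mean_integrable hm.
rewrite /laplace -RintegralB//; try exact: expRN_integrable.
rewrite -RintegralZl//.
have ii : mu.-integrable H
    (EFin \o (fun t => expR (- (s * t)) - expR (- (s' * t)))).
  apply: (@half_line_bounded_integrable _ 1).
    by apply: measurable_funB; exact: measurable_expRN.
  move=> t t0; have /andP[a0 a1] := expRN_ge0_le1 (mulr_ge0 s0 t0).
  have /andP[b0 b1] := expRN_ge0_le1 (mulr_ge0 s'0 t0).
  by rewrite ler_norml; lra.
apply: (le_trans (le_normr_Rintegral _ _)) => //.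
apply: le_Rintegral => //.
- exact: integrable_norm.
- exact: (integrableZl _ `|s - s'| im).
- move=> t /=; rewrite in_itv/= andbT => t0.
  apply: (le_trans (expRN_lipschitz _ _)); try exact: mulr_ge0.
  by rewrite -mulrBl normrM (ger0_norm t0).
Qed.

Lemma one_sub_laplace_le (s : R) : (mean mu < +oo)%E -> 0 <= s ->
  1 - laplace mu s <= s * fine (mean mu).
Proof.
move=> hm s0; have := laplace_lipschitz hm (lexx 0) s0.
rewrite laplace0 sub0r normrN (ger0_norm s0); apply: le_trans.
exact: ler_norm.
Qed.

(** The quotient (1 - laplace mu s) / s is nonincreasing in s, so its value at a fixed s bounds from
    below its values at vanishing arguments, uniformly in the measure. *)
Lemma one_sub_laplace_ratio (s s' : R) : 0 <= s -> s <= s' ->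
  s * (1 - laplace mu s') <= s' * (1 - laplace mu s).
Proof.
move=> s0 ss'; have s'0 := le_trans s0 ss'.
rewrite !one_sub_laplace// -!RintegralZl//; try exact: one_sub_expRN_integrable.
apply: le_Rintegral => //.
- exact: (integrableZl _ s (one_sub_expRN_integrable s'0)).
- exact: (integrableZl _ s' (one_sub_expRN_integrable s0)).
- move=> t /=; rewrite in_itv/= andbT le_eqVlt => /predU1P[<-|t0].
    by rewrite !mulr0 oppr0 expR0 subrr !mulr0.
  have := @one_sub_expRN_ratio _ (s * t) (s' * t).
  rewrite ler_pM2r// => /(_ (mulr_ge0 s0 (ltW t0)) ss').
  by rewrite -mulrA -[leRHS]mulrA !(mulrC t) !mulrA ler_pM2r.
Qed.

(** The quotient (1 - laplace mu s) / s tends to the mean as s tends to 0. It is taken along s = 1 /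
    (n + 1), dominated by the identity, which is integrable because the mean is finite. *)
Lemma mean_le_one_sub_laplace (eps : R) : (mean mu < +oo)%E -> 0 < eps ->
  exists s, 0 < s /\ s * (fine (mean mu) - eps) <= 1 - laplace mu s.
Proof.
move=> hm eps0; have im := half_line_mean_integrable hm.
pose f (n : nat) (t : R) : R := n.+1%:R * (1 - expR (- (n.+1%:R^-1 * t))).
have n0 n : 0 < n.+1%:R^-1 :> R by rewrite invr_gt0.
have f_le n (t : R) : 0 <= t -> t / (1 + n.+1%:R^-1 * t) <= f n t <= t.
  move=> t0; have nt0 : 0 <= n.+1%:R^-1 * t by rewrite mulr_ge0// ltW.
  have h1 := one_sub_expRN_ge nt0; have h2 := one_sub_expRN_le (n.+1%:R^-1 * t).
  have nE : t = n.+1%:R * (n.+1%:R^-1 * t) by rewrite mulrA mulfV// mul1r.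
  rewrite /f; apply/andP; split.
    by rewrite [X in X / _]nE -mulrA ler_pM2l.
  by rewrite [leRHS]nE ler_pM2l.
have mf n : measurable_fun setT (f n).
  by apply: measurable_funM => //; apply: measurable_funB => //; exact: measurable_expRN.
have inv0 : n.+1%:R^-1 @[n --> \oo] --> (0 : R) by exact: cvg_harmonic.
have fc (t : R) : t / (1 + n.+1%:R^-1 * t) @[n --> \oo] --> t.
  have : t / (1 + n.+1%:R^-1 * t) @[n --> \oo] --> t / (1 + 0 * t).
    apply: cvgM; first exact: cvg_cst.
    apply: cvgV; first by rewrite mul0r addr0 oner_eq0.
    by apply: cvgD; [exact: cvg_cst|apply: cvgM => //; exact: cvg_cst].
  by rewrite mul0r addr0 divr1.
have [_ _] : [/\ mu.-integrable H (EFin \o id),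
    [sequence \int[mu]_(x in H) `|(f n x)%:E - x%:E|]_n%E @ \oo --> 0%E &
    [sequence \int[mu]_(x in H) (f n x)%:E]_n%E @ \oo --> mean mu].
  apply: (@dominated_convergence _ _ _ mu H _ (fun n => EFin \o f n) (EFin \o id)
    (EFin \o id)) => //.
  - by move=> n; apply/measurable_EFinP; exact: (measurable_funTS (mf n)).
  - by apply/measurable_EFinP; exact: measurable_funTS.
  - apply: aeW => t /=; rewrite in_itv/= andbT => t0.
    apply/cvg_EFin; first by near=> n.
    apply: (@squeeze_cvgr _ _ _ _ (fun n => t / (1 + n.+1%:R^-1 * t)) (fun=> t)).
    + by near=> n; exact: f_le.
    + exact: fc.
    + exact: cvg_cst.
  - apply: aeW => t /= n; rewrite in_itv/= andbT => t0.
    have /andP[h1 h2] := f_le n t t0; rewrite lee_fin ger0_norm//.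
    apply: le_trans h1; rewrite divr_ge0// addr_ge0// mulr_ge0//; exact: ltW.
have fm : mean mu \is a fin_num by apply: integrable_fin_num im.
rewrite -(fineK fm) => /fine_cvg fcm.
have lt_m : fine (mean mu) - eps < fine (mean mu) by rewrite ltrBlDr ltrDl.
have [n _ /(_ n (leqnn _)) /= h] := cvgr_gt _ fcm _ lt_m.
exists n.+1%:R^-1; split => //.
rewrite ler_pdivrMl//; apply/ltW; apply: (lt_le_trans h).
rewrite one_sub_laplace; last exact: ltW.
by rewrite -RintegralZl//; apply: one_sub_expRN_integrable; exact: ltW.
Unshelve. all: by end_near. Qed.

End half_line_integrals.

(** * Continuity theorem for Laplace transforms *)

(** The discontinuities are countable and cannot fill an interval of positive Lebesgue measure. *)
Lemma nondecreasing_continuity_point (R : realType) (f : R -> R) (a b : R) :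
  {homo f : x y / x <= y} -> a < b ->
  exists t, [/\ a < t, t < b & {for t, continuous f}].
Proof.
move=> ndf ab; apply: contrapT => noc.
have /countable_lebesgue_measure0 := @discontinuity_countable _ a b f
  (fun x y _ _ => @ndf x y).
have -> : [set x | x \in (`]a, b[) /\ discontinuity f x] = `]a, b[%classic.
  apply/seteqP; split => [x [] //|t /= abt]; split => //.
  have cl : cvg (f x @[x --> t^'-]).
    apply: nondecreasing_at_left_is_cvgr; first by near=> x => y z _ _; exact: ndf.
    near=> x; exists (f t) => _ [y /= + <-]; rewrite in_itv/= => /andP[_ yt].
    exact/ndf/ltW.
  have cr : cvg (f x @[x --> t^'+]).
    apply: nondecreasing_at_right_is_cvgr; first by near=> x => y z _ _; exact: ndf.
    near=> x; exists (f t) => _ [y /= + <-]; rewrite in_itv/= => /andP[ty _].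
    exact/ndf/ltW.
  split => //; apply/eqP => lr; apply: noc; exists t.
  move: abt; rewrite in_itv/= => /andP[-> ->]; split => //.
  have lt : lim (f x @[x --> t^'-]) <= f t.
    by apply: limr_le => //; near=> x; apply: ndf; apply: ltW; near: x;
      exact: nbhs_left_lt.
  have rt : f t <= lim (f x @[x --> t^'+]).
    by apply: limr_ge => //; near=> x; apply: ndf; apply: ltW; near: x;
      exact: nbhs_right_gt.
  apply/left_right_continuousP; split.
    by rewrite (_ : f t = lim (f x @[x --> t^'-]))//; apply/eqP; rewrite eq_le lt lr rt.
  by rewrite (_ : f t = lim (f x @[x --> t^'+]))//; apply/eqP; rewrite eq_le rt -lr lt.
rewrite lebesgue_measure_itv/= lte_fin ab -EFinB => -[] /eqP.
by rewrite subr_eq0 gt_eqF.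
Unshelve. all: by end_near. Qed.

Section step_approximation.
Context (R : realType) (s : R) (x : nat -> R).
Hypotheses (s_ge0 : 0 <= s) (x_ndecr : {homo x : m n / (m <= n)%N >-> m <= n}).

Let c n := expR (- (s * x n)).

Let c_nincr m n : (m <= n)%N -> c n <= c m.
Proof. by move=> mn; rewrite ler_expR lerN2 ler_wpM2l// x_ndecr. Qed.

(** If m < n is the first index with t <= x m, the sum telescopes to c m - c n: a lower step
    function of the exponential, shifted down by c n. Written with half lines, it integrates to a
    combination of values of the distribution function. *)
Let g n (t : R) := \sum_(m < n) (c m - c m.+1) * \1_(`]-oo, x m]%classic) t.

Let g_ge0 n t : 0 <= g n t.
Proof. by apply: sumr_ge0 => m _; rewrite mulr_ge0// subr_ge0 c_nincr. Qed.

Let g_eq0 n t : x n < t -> g n.+1 t = 0.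
Proof.
move=> xt; apply: big1 => m _; rewrite indicE memNset ?mulr0//=.
rewrite in_itv/= => /(lt_le_trans xt); rewrite ltNge x_ndecr//.
by rewrite -ltnS.
Qed.

Let gS n t : t <= x n -> g n.+1 t = g n t + (c n - c n.+1).
Proof.
by move=> tx; rewrite /g big_ord_recr/= indicE mem_set ?mulr1//= in_itv.
Qed.

Let g_add_le n t : t <= x n -> g n t + c n <= expR (- (s * t)).
Proof.
elim: n => [|n ih] tx.
  by rewrite /g big_ord0 add0r ler_expR lerN2 ler_wpM2l.
have [tx'|xt] := leP t (x n).
  by rewrite gS// addrA subrK; exact: ih.
by rewrite g_eq0// add0r ler_expR lerN2 ler_wpM2l.
Qed.

Let g_le n t : g n t <= expR (- (s * t)).
Proof.
have [tx|xt] := leP t (x n).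
  by apply: le_trans (g_add_le tx); rewrite lerDl expR_ge0.
case: n xt => [|n] xt; first by rewrite /g big_ord0 expR_ge0.
by rewrite g_eq0 ?expR_ge0//; apply: le_lt_trans xt; exact: x_ndecr.
Qed.

Let g_ge n t (eta : R) : 0 <= t -> 1 - c 0 <= eta ->
  (forall m, c m - c m.+1 <= eta) -> expR (- (s * t)) <= g n t + (eta + c n).
Proof.
move=> t0 c0 ceta; elim: n => [|n ih].
  rewrite /g big_ord0 add0r; have /andP[_] := expRN_ge0_le1 (mulr_ge0 s_ge0 t0).
  by lra.
have [tx|xt] := leP t (x n); first by rewrite gS//; lra.
have := g_ge0 n.+1 t; have := ceta n.
have : expR (- (s * t)) <= c n by rewrite ler_expR lerN2 ler_wpM2l// ltW.
by lra.
Qed.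

(** Here [eta] bounds the oscillation of the exponential on each cell, the initial cell from 0 to
    [x 0] included, and the last exponential is the cost of truncating at [x n]. *)
Lemma laplace_step_approximation (mu : Rprobability R) (a eta : R) n :
  on_half_line mu -> 0 < a -> 1 - expR (- (s * x 0)) <= eta ->
  (forall m, expR (- (s * x m)) - expR (- (s * x m.+1)) <= eta) ->
  0 <= laplace mu (s / a) -
    \sum_(m < n) (expR (- (s * x m)) - expR (- (s * x m.+1))) * df mu (x m * a)
  <= eta + expR (- (s * x n)).
Proof.
move=> mu0 a0 h0 hm; pose H := (`[0%R, +oo[%classic : set (measurableTypeR R)).
have mH : measurable H by exact: measurable_itv.
pose G k (t : R) := \sum_(m < k) (c m - c m.+1) * \1_(`]-oo, x m * a]%classic) t.
have GE k t : G k t = g k (t / a).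
  apply: eq_bigr => m _; congr (_ * _); rewrite !indicE; congr ((nat_of_bool _)%:R).
  by apply/idP/idP; rewrite !inE/= !in_itv/= ler_pdivrMr.
have mG k : measurable_fun setT (G k).
  apply: measurable_sum => m; apply: measurable_funM => //.
have Gbnd k t : 0 <= t -> `|G k t| <= 1.
  move=> t0; have ta0 : 0 <= t / a by rewrite divr_ge0// ltW.
  rewrite GE ger0_norm//; apply: le_trans (g_le _ _) _.
  by have /andP[] := expRN_ge0_le1 (mulr_ge0 s_ge0 ta0).
have iG k : mu.-integrable H (EFin \o G k).
  exact: half_line_bounded_integrable (mG k) (Gbnd k).
have intG k : \int[mu]_(t in H) G k t = \sum_(m < k) (c m - c m.+1) * df mu (x m * a).
  elim: k => [|k ih].
    rewrite big_ord0 (_ : G 0 = fun=> 0) ?half_line_integral_cst//.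
    by apply/funext => t; rewrite /G big_ord0.
  rewrite big_ord_recr/= -ih.
  rewrite (_ : G k.+1 = fun t => G k t +
      (c k - c k.+1) * \1_(`]-oo, x k * a]%classic) t); last first.
    by apply/funext => t; rewrite /G big_ord_recr.
  have ii : mu.-integrable H (EFin \o \1_(`]-oo, x k * a]%classic)).
    apply: (@half_line_bounded_integrable _ _ _ 1).
      exact: measurable_indic.
    by move=> t _; rewrite indicE normr_nat lern1 leq_b1.
  rewrite RintegralD//; last exact: (integrableZl _ (c k - c k.+1) ii).
  by rewrite RintegralZl// half_line_integral_indic.
have sa0 : 0 <= s / a by rewrite divr_ge0// ltW.
have il := expRN_integrable mu sa0.
rewrite -intG /laplace -RintegralB//.
have LE t : s / a * t = s * (t / a) by rewrite -mulrA (mulrC _ t).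
apply/andP; split.
  by apply: Rintegral_ge0 => t _; rewrite subr_ge0 GE LE.
rewrite -[leRHS](half_line_integral_cst mu0); apply: le_Rintegral => //.
- exact: (integrableB mH il (iG n)).
- apply: (@half_line_bounded_integrable _ _ _ `|eta + expR (- (s * x n))|) => //.
- move=> t /=; rewrite in_itv/= andbT => t0.
  by rewrite lerBlDl GE LE; apply: g_ge => //; rewrite divr_ge0// ltW.
Qed.

End step_approximation.

Section laplace_continuity.
Context (R : realType) (I : Type) (F : set_system I) {FF : ProperFilter F}.
Context (mu : I -> Rprobability R) (a : I -> R).
Hypothesis mu_half_line : \forall e \near F, on_half_line (mu e).
Hypothesis a_gt0 : \forall e \near F, 0 < a e.

Lemma df_cvg_laplace (mu0 : Rprobability R) : on_half_line mu0 ->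
  (forall t, {for t, continuous (df mu0)} ->
     df (mu e) (t * a e) @[e --> F] --> df mu0 t) ->
  forall s, 0 <= s -> laplace (mu e) (s / a e) @[e --> F] --> laplace mu0 s.
Proof.
move=> hmu0 cdf s; rewrite le_eqVlt => /predU1P[<-|s0].
  rewrite laplace0//; apply: cvg_near_cst; near=> e.
  by rewrite mul0r laplace0//; near: e.
apply/cvgrPdist_le => eps eps0.
(* Both step approximations err on the same side, by at most [2 * h + h], and their sums differ by
   at most [h], so eight times [h] leaves room. *)
pose h := eps / 8; have h0 : 0 < h by rewrite divr_gt0.
pose b := h / s; have b0 : 0 < b by rewrite divr_gt0.
(* One continuity point in each cell of length [b = h / s]: consecutive points are less than [2 * b]
   apart, whence the oscillation [2 * h]. *)
have /choice[x xP] (n : nat) : exists t,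
    [/\ n%:R * b < t, t < n.+1%:R * b & {for t, continuous (df mu0)}].
  apply: nondecreasing_continuity_point; first exact: df_homo.
  by rewrite ltr_pM2r// ltr_nat.
have xS n : x n <= x n.+1.
  by have [_ h1 _] := xP n; have [h2 _ _] := xP n.+1; rewrite ltW// (lt_trans h1).
have x_ndecr : {homo x : m n / (m <= n)%N >-> m <= n}.
  exact: (@homo_leq _ x _ (@lexx _ _) (@le_trans _ _) xS).
have xge0 n : 0 <= x n.
  by have [h1 _ _] := xP n; rewrite (le_trans _ (ltW h1))// mulr_ge0// ltW.
have sb : s * b = h by rewrite /b mulrC divfK// gt_eqF.
have e0 : 1 - expR (- (s * x 0)) <= 2 * h.
  have [_ h1 _] := xP 0%N; have := one_sub_expRN_le (s * x 0).
  have : s * x 0 <= s * (1 * b) by rewrite ler_pM2l// ltW.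
  by rewrite mul1r sb; lra.
have eS m : expR (- (s * x m)) - expR (- (s * x m.+1)) <= 2 * h.
  have [h1 _ _] := xP m; have [_ h2 _] := xP m.+1.
  apply: le_trans (ler_norm _) _.
  apply: le_trans (expRN_lipschitz _ _) _; rewrite ?mulr_ge0// ?(ltW s0)//.
  rewrite -mulrBr normrM (gtr0_norm s0) distrC ger0_norm ?subr_ge0//.
  have : s * (x m.+1 - x m) <= s * (m.+2%:R * b - m%:R * b).
    by rewrite ler_pM2l// lerB// ltW.
  by rewrite -mulrBl mulrCA sb -natrB ?leqW// -addn2 addnC addnK.
have [n en] : exists n, expR (- (s * x n)) <= h.
  (* Then [s * x n] exceeds [n * h], hence [1 / h], and exp y >= 1 + y brings the tail below [h]. *)
  pose n := Num.bound (h^-1 / h); exists n.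
  have hn : h^-1 / h < n%:R by apply: archi_boundP; rewrite divr_ge0// ?invr_ge0 ltW.
  have [h1 _ _] := xP n.
  rewrite expRN invf_ple ?posrE ?expR_gt0//; apply: le_trans (expR_ge1Dx _).
  have h2 : s * (n%:R * b) <= s * x n by rewrite ler_pM2l// ltW.
  rewrite ltr_pdivrMr// in hn; rewrite mulrCA sb in h2; lra.
pose S (m : Rprobability R) (c : R) := \sum_(k < n)
  (expR (- (s * x k)) - expR (- (s * x k.+1))) * df m (x k * c).
have Sc : S (mu e) (a e) @[e --> F] --> S mu0 1.
  apply: cvg_big => [|k _]; first exact: add_continuous.
  apply: cvgM; first exact: cvg_cst.
  by rewrite mulr1; apply: cdf; have [] := xP k.
near=> e.
have ae : 0 < a e by near: e.
have he : on_half_line (mu e) by near: e.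
have /andP[p1 p2] := @laplace_step_approximation _ s x (ltW s0) x_ndecr mu0 1
  (2 * h) n hmu0 ltr01 e0 eS.
have /andP[p3 p4] := @laplace_step_approximation _ s x (ltW s0) x_ndecr (mu e)
  (a e) (2 * h) n he ae e0 eS.
have : `|S mu0 1 - S (mu e) (a e)| <= h.
  by near: e; move/cvgrPdist_le : Sc; exact.
rewrite ler_norml => /andP[p5 p6].
rewrite divr1 in p1 p2; rewrite -/(S mu0 1) in p1 p2.
rewrite -/(S (mu e) (a e)) in p3 p4.
have eps8 : eps = 8 * h by rewrite /h mulrC divfK.
by rewrite ler_norml eps8; apply/andP; split; lra.
Unshelve. all: by end_near. Qed.

Lemma cvg_family_laplace (mu0 : Rprobability R) : on_half_line mu0 ->
  (forall t, {for t, continuous (df mu0)} ->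
     df (mu e) (t * a e) @[e --> F] --> df mu0 t) ->
  (\forall e \near F, (mean (mu e) < +oo)%E) -> (mean mu0 < +oo)%E ->
  fine (mean (mu e)) / a e @[e --> F] --> fine (mean mu0) ->
  cvg_family F (fun e s => laplace (mu e) (s / a e)) (laplace mu0)
    (fine (mean mu0)).
Proof.
move=> hmu0 /(df_cvg_laplace hmu0) lc fm fm0 mc.
have m_ge0 := fine_mean_ge0 mu0.
split.
- near=> e => s s0; apply: laplace_ge0_le1; first by near: e.
  by rewrite divr_ge0//; apply: ltW; near: e.
- move=> u u0 u_ge0 uu0; have u0_ge0 : 0 <= u0 by exact: cvgr_to_ge uu0 _.
  (* Replacing [u0] by [u e] costs at most [|u e - u0|] times the normalised mean, which converges
     and so stays bounded. *)
  have d0 : laplace (mu e) (u e / a e) - laplace (mu e) (u0 / a e)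
      @[e --> F] --> (0 : R).
    apply/norm_cvg0P.
    apply: (@squeeze_cvgr _ _ _ _ (fun=> 0)
      (fun e => `|u e - u0| * (fine (mean (mu e)) / a e))).
    + near=> e; rewrite normr_ge0/=.
      have ae : 0 < a e by near: e.
      apply: (le_trans (laplace_lipschitz _ _ _)).
      * by near: e.
      * by rewrite divr_ge0 ?(ltW ae)//; near: e.
      * by rewrite divr_ge0 ?(ltW ae).
      * by rewrite -mulrBl normrM normfV (gtr0_norm ae) mulrAC mulrA.
    + exact: cvg_cst.
    + rewrite -[X in _ --> X](mul0r (fine (mean mu0))); apply: cvgM => //.
      rewrite -[X in _ --> X](@normr0 _ R); apply: cvg_norm.
      by rewrite -[X in _ --> X](subrr u0); apply: cvgB => //; exact: cvg_cst.
  rewrite (_ : (fun e => _) = fun e => laplace (mu e) (u e / a e) -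
      laplace (mu e) (u0 / a e) + laplace (mu e) (u0 / a e)); last first.
    by apply/funext => e; rewrite subrK.
  by rewrite -[X in _ --> X]add0r; apply: cvgD => //; exact: lc.
- move=> u dl u0 u_ge0 uu0 dl_gt0 dl0.
  have u0_ge0 : 0 <= u0 by exact: cvgr_to_ge uu0 _.
  apply/cvgrPdist_le => eps eps0.
  (* The difference quotient lies below the normalised mean ([p3]) and, by monotonicity, above the
     quotient at a fixed [s] ([p4]). That quotient misses the mean by at most [h], which costs
     [u0 * h], and the passage to the limit costs another [h]: together [eps / 2]. *)
  pose h := eps / (2 * (u0 + 1)).
  have u1 : 0 < u0 + 1 by rewrite ltr_wpDl.
  have h0 : 0 < h by rewrite divr_gt0// mulr_gt0.
  have hE : 2 * (u0 * h + h) = eps by rewrite /h; field; rewrite gt_eqF.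
  have [s [s0 sP]] := mean_le_one_sub_laplace hmu0 fm0 h0.
  have upper : u e * (fine (mean (mu e)) / a e) @[e --> F] --> u0 * fine (mean mu0).
    exact: cvgM.
  have lower : u e * ((1 - laplace (mu e) (s / a e)) / s) @[e --> F] -->
      u0 * ((1 - laplace mu0 s) / s).
    apply: cvgM => //; apply: cvgM; last exact: cvg_cst.
    by apply: cvgB; [exact: cvg_cst|apply: lc; exact: ltW].
  have dlu : dl e * u e @[e --> F] --> (0 : R).
    by rewrite -[X in _ --> X](mul0r u0); exact: cvgM.
  have sP' : u0 * (fine (mean mu0) - h) <= u0 * ((1 - laplace mu0 s) / s).
    by rewrite ler_wpM2l// ler_pdivlMr// mulrC.
  near=> e.
  have ae : 0 < a e by near: e.
  have de : 0 < dl e by near: e.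
  have ue : 0 <= u e by near: e.
  have he : on_half_line (mu e) by near: e.
  have me : (mean (mu e) < +oo)%E by near: e.
  have dus : dl e * u e <= s by near: e; apply: cvgr_le dlu _ s0.
  have [p1 p2] : u e * (fine (mean (mu e)) / a e) <= u0 * fine (mean mu0) + eps /\
      u0 * ((1 - laplace mu0 s) / s) - h <=
      u e * ((1 - laplace (mu e) (s / a e)) / s).
    split; near: e.
      by apply: cvgr_le upper _ _; rewrite ltrDl.
    by apply: cvgr_ge lower _ _; rewrite ltrBlDr ltrDl.
  have due : 0 <= dl e * u e by rewrite mulr_ge0// ltW.
  have p3 : (1 - laplace (mu e) (dl e * u e / a e)) / dl e <=
      u e * (fine (mean (mu e)) / a e).
    rewrite ler_pdivrMr//; apply: le_trans (one_sub_laplace_le _ _ _) _ => //.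
      by rewrite divr_ge0// ltW.
    rewrite le_eqVlt; apply/orP; left; apply/eqP.
    by field; rewrite gt_eqF.
  have p4 : u e * ((1 - laplace (mu e) (s / a e)) / s) <=
      (1 - laplace (mu e) (dl e * u e / a e)) / dl e.
    rewrite ler_pdivlMr// mulrC !mulrA ler_pdivrMr// [leRHS]mulrC.
    have : dl e * u e / a e * (1 - laplace (mu e) (s / a e)) <=
       s / a e * (1 - laplace (mu e) (dl e * u e / a e)).
      apply: one_sub_laplace_ratio => //; first by rewrite divr_ge0// ltW.
      by rewrite ler_pM2r ?invr_gt0.
    by rewrite mulrAC (mulrAC s) ler_pM2r ?invr_gt0.
  by rewrite ler_norml; apply/andP; split; nra.
- split=> // s s0; have /andP[-> ->] := laplace_ge0_le1 hmu0 s0; split => //.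
  by have := one_sub_laplace_le hmu0 fm0 s0; lra.
Unshelve. all: by end_near. Qed.

End laplace_continuity.

(** * Construction of the limit law from convergent transforms *)

Section probability_of_df.
Context (R : realType) (f : R -> R).
Hypotheses (f_homo : nondecreasing f) (f_rc : right_continuous f).
Hypotheses (f_Ny : f @ -oo --> (0 : R)) (f_y : f @ +oo --> (1 : R)).

#[local] HB.instance Definition _ := isCumulative.Build R _ R f f_homo f_rc.
#[local] HB.instance Definition _ := isCumulativeBounded.Build R 0 1 f f_Ny f_y.

Lemma probability_of_df : exists P : Rprobability R, forall t, df P t = f t.
Proof.
exists (lebesgue_stieltjes_measure f) => t.
by rewrite /df; have /(congr1 fine) := cdf_lebesgue_stieltjes_id f t.
Qed.

End probability_of_df.

Lemma bernoulli_ge (R : realType) (x : R) n : 0 <= x <= 1 ->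
  1 - n%:R * x <= (1 - x) ^+ n.
Proof.
move=> /andP[x0 x1]; elim: n => [|n ih]; first by rewrite mul0r subr0 expr0.
rewrite exprS -natr1.
have /ler_wpM2l/(_ _ _ ih) : 0 <= 1 - x by lra.
apply: le_trans; have : 0 <= n%:R * x * x by rewrite !mulr_ge0.
by nra.
Qed.

Lemma bernoulli_le (R : realType) (x : R) n : 0 <= x <= 1 ->
  (1 - x) ^+ n * (1 + n%:R * x) <= 1.
Proof.
move=> /andP[x0 x1]; elim: n => [|n ih]; first by rewrite mul0r addr0 expr0 mulr1.
apply: le_trans ih; rewrite exprSr -mulrA ler_wpM2l ?exprn_ge0 ?subr_ge0//.
have : 0 <= n%:R * x * x by rewrite !mulr_ge0.
by rewrite -natr1; nra.
Qed.

(* With [n] close to [exp (s c)], [c] the midpoint of [a] and [b], the factor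
[exp (- s t)] of [(1 - exp (- s t)) ^+ n] is much larger than [1 / n] left of [a]
and much smaller right of [b]. *)
Lemma separating_power (R : realType) (a b eta : R) : 0 <= a -> a < b -> 0 < eta ->
  exists (s : R) (n : nat), [/\ 0 <= s,
    forall t, 0 <= t -> t <= a -> (1 - expR (- (s * t))) ^+ n <= eta &
    forall t, b <= t -> 1 - eta <= (1 - expR (- (s * t))) ^+ n].
Proof.
move=> a0 ab eta0; pose d := (b - a) / 2; pose c := a + d.
have d0 : 0 < d by rewrite divr_gt0// subr_gt0.
(* With [s * d = 2 / eta], exp y >= 1 + y gives exp (- s d) <= eta / 2; rounding exp (s c) to [n]
   loses at most a factor 2, which this half absorbs. *)
pose s := 2 / (eta * d); have s0 : 0 < s by rewrite divr_gt0// mulr_gt0.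
pose n := (Num.truncn (expR (s * c))).+1; exists s, n.
have n1 : expR (s * c) <= n%:R by rewrite ltW// truncnS_gt.
have sc1 : 1 <= expR (s * c).
  by rewrite -expR0 ler_expR mulr_ge0 ?(ltW s0)// addr_ge0// ltW.
have n2 : n%:R <= 2 * expR (s * c).
  rewrite /n -natr1; have : (Num.truncn (expR (s * c)))%:R <= expR (s * c).
    by rewrite truncn_le// expR_ge0.
  by lra.
have small : expR (- (s * d)) <= eta / 2.
  have sdE : s * d = 2 / eta by rewrite /s; field; rewrite !gt_eqF.
  rewrite expRN sdE invf_ple ?posrE ?expR_gt0 ?divr_gt0// invf_div.
  by apply: le_trans (expR_ge1Dx _); rewrite lerDr.
have x01 t : 0 <= t -> 0 <= expR (- (s * t)) <= 1.
  by move=> t0; apply: expRN_ge0_le1; rewrite mulr_ge0// ltW.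
split; first exact: ltW.
- move=> t t0 ta; set x := expR _.
  have B := bernoulli_le n (x01 t t0); rewrite -/x in B.
  have /andP[xge xle] := x01 t t0; rewrite -/x in xge xle.
  have nx : 2 / eta <= n%:R * x.
    have h1 : expR (s * d) <= n%:R * x.
      have : expR (s * c) * x <= n%:R * x by rewrite ler_wpM2r.
      apply: le_trans; rewrite -expRD ler_expR -mulrN -mulrDr ler_pM2l// /c; lra.
    apply: le_trans h1.
    by rewrite -[leRHS]invrK -expRN -invf_div lef_pV2 ?posrE ?expR_gt0 ?divr_gt0.
  have p0 : 0 <= (1 - x) ^+ n by rewrite exprn_ge0// subr_ge0.
  have h2 : (1 - x) ^+ n * (2 / eta) <= 1.
    by apply: le_trans B; rewrite ler_wpM2l// (le_trans nx)// lerDr.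
  by rewrite mulrA ler_pdivrMr// mul1r in h2; lra.
- move=> t bt; set x := expR _.
  have t0 : 0 <= t by lra.
  have B := bernoulli_ge n (x01 t t0); rewrite -/x in B; apply: le_trans B.
  have /andP[xge xle] := x01 t t0; rewrite -/x in xge xle.
  have h1 : n%:R * x <= 2 * expR (s * c) * x by rewrite ler_wpM2r.
  have h2 : expR (s * c) * x <= expR (- (s * d)).
    by rewrite -expRD ler_expR -!mulrN -mulrDr ler_pM2l// /c /d; lra.
  by nra.
Qed.

Section laplace_inversion.
Context (R : realType) (I : Type) (F : set_system I) {FF : ProperFilter F}.
Context (mu : I -> Rprobability R) (a : I -> R) (phi : R -> R) (C : R).
Hypothesis mu_half_line : \forall e \near F, on_half_line (mu e).
Hypothesis a_gt0 : \forall e \near F, 0 < a e.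
Hypothesis laplace_phi : forall s, 0 <= s ->
  laplace (mu e) (s / a e) @[e --> F] --> phi s.
Hypothesis phi_ge : forall s, 0 <= s -> 1 - C * s <= phi s.
Local Notation H := (`[0%R, +oo[%classic : set (measurableTypeR R)).

Let G e t := df (mu e) (t * a e).

Let G_homo e t t' : 0 < a e -> t <= t' -> G e t <= G e t'.
Proof. by move=> ae tt'; apply: df_homo; rewrite ler_pM2r. Qed.

Let pow s n e (t : R) := (1 - expR (- (s / a e * t))) ^+ n.

Let pow_bnd s n e t : 0 < a e -> 0 <= s -> 0 <= t -> 0 <= pow s n e t <= 1.
Proof.
move=> ae s0 t0.
have /andP[h0 h1] : 0 <= expR (- (s / a e * t)) <= 1.
  by apply: expRN_ge0_le1; rewrite mulr_ge0// divr_ge0// ltW.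
by rewrite exprn_ge0 ?subr_ge0// exprn_ile1 ?subr_ge0//; lra.
Qed.

Let exp_pow_integrable s n r e : 0 < a e -> 0 <= s -> 0 <= r ->
  (mu e).-integrable H (EFin \o (fun t => expR (- (r / a e * t)) * pow s n e t)).
Proof.
move=> ae s0 r0; apply: (@half_line_bounded_integrable _ _ _ 1).
  apply: measurable_funM; first exact: measurable_expRN.
  apply: measurable_funX; apply: measurable_funB => //; exact: measurable_expRN.
move=> t t0; have /andP[h0 h1] := pow_bnd n ae s0 t0.
have /andP[k0 k1] : 0 <= expR (- (r / a e * t)) <= 1.
  by apply: expRN_ge0_le1; rewrite mulr_ge0// divr_ge0// ltW.
by rewrite ger0_norm ?mulr_ge0// mulr_ile1.
Qed.

Let pow_integrable s n e : 0 < a e -> 0 <= s ->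
  (mu e).-integrable H (EFin \o pow s n e).
Proof.
move=> ae s0; have := exp_pow_integrable n ae s0 (lexx 0).
rewrite (_ : (fun t => _) = pow s n e)//; apply/funext => t.
by rewrite mul0r mul0r oppr0 expR0 mul1r.
Qed.

(** A power expands into transforms at multiples of [s], which converge. The factor with [r] makes
    the induction close: (1 - x)^(n+1) = (1 - x)^n - x (1 - x)^n shifts [r] to [r + s]. *)
Let exp_pow_cvg s n r : 0 <= s -> 0 <= r -> exists l : R,
  \int[mu e]_(t in H) (expR (- (r / a e * t)) * pow s n e t) @[e --> F] --> l.
Proof.
move=> s0; elim: n r => [|n ih] r r0.
  exists (phi r); apply: cvg_trans (laplace_phi r0); apply: near_eq_cvg.
  by near=> e; apply: eq_Rintegral => t _; rewrite /pow expr0 mulr1.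
have [l hl] := ih r r0; have [l' hl'] := ih (r + s) (addr_ge0 r0 s0).
exists (l - l'); apply: (cvg_trans _ (cvgB hl hl')); apply: near_eq_cvg.
near=> e; have ae : 0 < a e by near: e.
rewrite !fctE -RintegralB//=.
- apply: eq_Rintegral => t _; rewrite /pow exprS.
  rewrite (_ : - ((r + s) / a e * t) = - (r / a e * t) + - (s / a e * t)).
    by rewrite expRD; ring.
  by rewrite mulrDl; ring.
- exact: exp_pow_integrable.
- by apply: exp_pow_integrable => //; exact: addr_ge0.
Unshelve. all: by end_near. Qed.

Let pow_cvg s n : 0 <= s -> exists l : R,
  \int[mu e]_(t in H) pow s n e t @[e --> F] --> l.
Proof.
move=> s0; have [l hl] := exp_pow_cvg n s0 (lexx 0); exists l.
apply: cvg_trans hl; apply: near_eq_cvg; near=> e; apply: eq_Rintegral => t _.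
by rewrite mul0r mul0r oppr0 expR0 mul1r.
Unshelve. all: by end_near. Qed.

(* Both [G e x] and [G e y] are compared to the same convergent integral of a
separating power. *)
Let G_squeeze x y eta : 0 <= x -> x < y -> 0 < eta ->
  exists z, \forall e \near F, G e x <= z /\ z - eta <= G e y.
Proof.
move=> x0 xy eta0; have h0 : 0 < eta / 4 by rewrite divr_gt0.
have [s [n [s0 hx hy]]] := separating_power x0 xy h0.
have [l hl] := pow_cvg n s0.
exists (1 - l + eta / 2); near=> e.
have ae : 0 < a e by near: e.
have he : on_half_line (mu e) by near: e.
have : `|l - \int[mu e]_(t in H) pow s n e t| <= eta / 4.
  by near: e; move/cvgrPdist_le : hl; exact.
rewrite ler_norml => /andP[l1 l2].
have ind_int z : (mu e).-integrable H (EFin \o (fun t => \1_(`]-oo, z]%classic) t)).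
  apply: (@half_line_bounded_integrable _ _ _ 1); first exact: measurable_indic.
  by move=> t _; rewrite indicE normr_nat lern1 leq_b1.
have cst_int (z : R) : (mu e).-integrable H (EFin \o (fun=> z)).
  by apply: (@half_line_bounded_integrable _ _ _ `|z|).
have tE t : s / a e * t = s * (t / a e) by rewrite -mulrA (mulrC _ t).
split.
  have : \int[mu e]_(t in H) (pow s n e t + \1_(`]-oo, x * a e]%classic) t)
      <= 1 + eta / 4.
    rewrite -[leRHS](half_line_integral_cst he); apply: le_Rintegral => //.
      exact: (integrableD _ (pow_integrable n ae s0) (ind_int _)).
    move=> t /=; rewrite in_itv/= andbT => t0.
    have /andP[_ h1] := pow_bnd n ae s0 t0.
    rewrite indicE; case: (boolP (_ \in _)) => [|_] /=; last by rewrite addr0; lra.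
    rewrite inE/= in_itv/= -ler_pdivrMr// => tx; rewrite addrC lerD2l /pow tE.
    by apply: hx => //; rewrite divr_ge0// ltW.
  rewrite RintegralD//; last exact: pow_integrable.
  by rewrite half_line_integral_indic//; rewrite /G; lra.
have : 1 - eta / 4 <=
    \int[mu e]_(t in H) (pow s n e t + \1_(`]-oo, y * a e]%classic) t).
  rewrite -[leLHS](half_line_integral_cst he); apply: le_Rintegral => //.
    exact: (integrableD _ (pow_integrable n ae s0) (ind_int _)).
  move=> t /=; rewrite in_itv/= andbT => t0.
  have /andP[h1 _] := pow_bnd n ae s0 t0.
  rewrite indicE; case: (boolP (_ \in _)) => [_|] /=; first by lra.
  rewrite notin_setE/= in_itv/= => /negP; rewrite -ltNge -ltr_pdivlMr// => yt.
  by rewrite addr0 /pow tE; apply: hy; exact: ltW.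
rewrite RintegralD//; last exact: pow_integrable.
by rewrite half_line_integral_indic//; rewrite /G; lra.
Unshelve. all: by end_near. Qed.

(** An exponential Markov inequality: beyond [b * a e] the integrand of 1 - laplace is at least 1/2,
    because x / (1 + x) >= 1/2 for x >= 1. *)
Let G_tight b : 0 < b -> \forall e \near F,
  1 - 2 * (1 - laplace (mu e) (b^-1 / a e)) <= G e b.
Proof.
move=> b0; near=> e.
have ae : 0 < a e by near: e.
have he : on_half_line (mu e) by near: e.
have b'0 : 0 <= b^-1 by rewrite invr_ge0 ltW.
have ba0 : 0 <= b^-1 / a e by rewrite divr_ge0// ltW.
have ind_int z : (mu e).-integrable H (EFin \o (fun t => \1_(`]-oo, z]%classic) t)).
  apply: (@half_line_bounded_integrable _ _ _ 1); first exact: measurable_indic.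
  by move=> t _; rewrite indicE normr_nat lern1 leq_b1.
have cst_int (z : R) : (mu e).-integrable H (EFin \o (fun=> z)).
  by apply: (@half_line_bounded_integrable _ _ _ `|z|).
have osi := one_sub_expRN_integrable (mu e) ba0.
have mH : measurable H by exact: measurable_itv.
have osi2 := integrableZl mH (2 : R) osi.
have : 1 <= \int[mu e]_(t in H) (2 * (1 - expR (- (b^-1 / a e * t))) +
    \1_(`]-oo, b * a e]%classic) t).
  rewrite -[leLHS](half_line_integral_cst he); apply: le_Rintegral => //.
    exact: (integrableD _ osi2 (ind_int _)).
  move=> t /=; rewrite in_itv/= andbT => t0.
  have bt0 : 0 <= b^-1 / a e * t by rewrite mulr_ge0.
  rewrite indicE; case: (boolP (_ \in _)) => [_|] /=.
    by have /andP[_] := expRN_ge0_le1 bt0; lra.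
  rewrite notin_setE/= in_itv/= => /negP; rewrite -ltNge => bt.
  have bt1 : 1 <= b^-1 / a e * t.
    by rewrite -invfM mulrC ler_pdivlMr ?mulr_gt0// mul1r ltW.
  have := one_sub_expRN_ge bt0; rewrite addr0.
  move: (b^-1 / a e * t) bt0 bt1 => x x0 x1.
  by rewrite ler_pdivrMr; nra.
rewrite RintegralD//.
rewrite RintegralZl// half_line_integral_indic// one_sub_laplace// /G; lra.
Unshelve. all: by end_near. Qed.

(** The infimum [L t] of this set is the infimum over b > t of the upper limits of [G e b] along
    [F]. Taking [b] strictly to the right of [t] makes [L] right-continuous, and [0 <= y] bounds the
    set from below. *)
Let bounds t := [set y : R | 0 <= y /\
  exists b, t < b /\ \forall e \near F, G e b <= y].

Let L t := inf (bounds t).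

Let bounds_has_inf t : has_inf (bounds t).
Proof.
split; last by exists 0 => y [].
exists 1; split=> //; exists (t + 1); rewrite ltrDl ltr01; split => //.
by near=> e; have /andP[] := df_ge0_le1 (mu e) ((t + 1) * a e).
Unshelve. all: by end_near. Qed.

Let L_le t y : bounds t y -> L t <= y.
Proof. by move=> ?; apply: ge_inf => //; have [] := bounds_has_inf t. Qed.

Let L_ge t z : (forall y, bounds t y -> z <= y) -> z <= L t.
Proof. by move=> h; apply: lb_le_inf => //; have [] := bounds_has_inf t. Qed.

Let L_lt t z : L t < z -> exists2 y, bounds t y & y < z.
Proof. by move=> h; apply: inf_lt => //; have [] := bounds_has_inf t. Qed.

Let L_homo : nondecreasing L.
Proof.
move=> t t' tt'; apply: L_ge => y [y0 [b [t'b hb]]]; apply: L_le; split => //.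
by exists b; split => //; exact: le_lt_trans t'b.
Qed.

Let L_rc : right_continuous L.
Proof.
move=> t; apply/cvgrPdist_le => eps eps0.
have [y [y0 [b [tb hb]]] yL] : exists2 y, bounds t y & y < L t + eps.
  by apply: L_lt; rewrite ltrDl.
near=> t'; rewrite distrC ger0_norm.
  rewrite lerBlDl; apply: le_trans (ltW yL); apply: L_le; split => //.
  by exists b; split => //; near: t'; exact: nbhs_right_lt.
rewrite subr_ge0; apply: L_homo; apply: ltW; near: t'; exact: nbhs_right_gt.
Unshelve. all: by end_near. Qed.

Let L_lt0 t : t < 0 -> L t = 0.
Proof.
move=> t0; apply/eqP; rewrite eq_le; apply/andP; split; last first.
  by apply: L_ge => y [].
apply: L_le; split => //; exists (t / 2); split; first by lra.
near=> e; have ae : 0 < a e by near: e.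
rewrite /G df_half_line//; first by near: e.
by rewrite pmulr_llt0//; lra.
Unshelve. all: by end_near. Qed.

Let L_le1 t : L t <= 1.
Proof.
apply: L_le; split => //; exists (t + 1); rewrite ltrDl ltr01; split => //.
by near=> e; have /andP[] := df_ge0_le1 (mu e) ((t + 1) * a e).
Unshelve. all: by end_near. Qed.

(** The lower bound on [phi] near 0 keeps mass from escaping, so that [L] tends to 1 at infinity;
    [C] has arbitrary sign, hence its absolute value. *)
Let L_ge_tight t : 0 < t -> 1 - 2 * (`|C| * t^-1) <= L t.
Proof.
move=> t0; apply: L_ge => y [y0 [b [tb hb]]].
have b0 := lt_trans t0 tb; have b'0 : 0 <= b^-1 by rewrite invr_ge0 ltW.
have h : 1 - 2 * (1 - laplace (mu e) (b^-1 / a e)) @[e --> F] -->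
    1 - 2 * (1 - phi b^-1).
  apply: cvgB; first exact: cvg_cst.
  apply: cvgM; first exact: cvg_cst.
  by apply: cvgB; [exact: cvg_cst|exact: laplace_phi].
have h1 : 1 - 2 * (1 - phi b^-1) <= y.
  apply: cvgr_to_le h _; have tight := G_tight b0; near=> e.
  by apply: (@le_trans _ _ (G e b)); near: e.
have h2 := phi_ge b'0.
have h3 : C * b^-1 <= `|C| * t^-1.
  apply: (@le_trans _ _ (`|C| * b^-1)); first by rewrite ler_wpM2r// ler_norm.
  by rewrite ler_wpM2l// lef_pV2 ?posrE// ltW.
lra.
Unshelve. all: by end_near. Qed.

Let L_y : L @ +oo --> (1 : R).
Proof.
apply/cvgrPdist_le => eps eps0; near=> t.
have t0 : 0 < t by near: t; exact: nbhs_pinfty_gt.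
rewrite ger0_norm ?subr_ge0 ?L_le1// lerBlDl -lerBlDr.
apply: le_trans (L_ge_tight t0); rewrite lerD2l lerN2.
rewrite mulrA ler_pdivrMr//.
have : 2 * `|C| / eps <= t by near: t; apply: nbhs_pinfty_ge; exact: num_real.
by rewrite ler_pdivrMr// (mulrC eps).
Unshelve. all: by end_near. Qed.

Let L_Ny : L @ -oo --> (0 : R).
Proof.
apply: cvg_near_cst; near=> t; apply: L_lt0; near: t; exact: nbhs_ninfty_lt.
Unshelve. all: by end_near. Qed.

(** Above, the definition of [L] suffices. Below, left continuity gives [c < t] with [L c] close to
    [L t]; a level [z] that bounds [G e x] for a point [x] between [c] and [t] satisfies [L c <= z],
    while the squeeze yields [z - eps / 2 <= G e t]. *)
Let G_cvg t : {for t, continuous L} -> G e t @[e --> F] --> L t.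
Proof.
move=> ct; apply/cvgrPdist_le => eps eps0.
have [y [y0 [b [tb hb]]] yL] : exists2 y, bounds t y & y < L t + eps.
  by apply: L_lt; rewrite ltrDl.
have upper : \forall e \near F, G e t <= L t + eps.
  near=> e; apply: (@le_trans _ _ (G e b)).
    by apply: G_homo; [near: e|exact: ltW].
  by apply: le_trans (ltW yL); near: e.
have lower : \forall e \near F, L t - eps <= G e t.
  have eps2 : 0 < eps / 2 by rewrite divr_gt0.
  have [c ct' cL] : exists2 c, c < t & L t - eps / 2 <= L c.
    have lc : L x @[x --> t^'-] --> L t by exact: cvg_at_left_filter.
    have lt_L : L t - eps / 2 < L t by rewrite ltrBlDr ltrDl.
    have h := cvgr_ge _ lc _ lt_L.
    near t^'- => c; exists c; near: c; first exact: nbhs_left_lt.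
    exact: h.
  (* [G_squeeze] asks for a nonnegative left point. If [c] is negative, [L c = 0] and nonnegativity
     of [G] is enough. *)
  have [c0|c0] := ltP c 0.
    near=> e; rewrite (L_lt0 c0) in cL.
    have /andP[+ _] := df_ge0_le1 (mu e) (t * a e); rewrite -/(G e t).
    by lra.
  pose x := (c + t) / 2; have x0 : 0 <= x by rewrite /x; lra.
  have cx : c < x by rewrite /x; lra.
  have xt : x < t by rewrite /x; lra.
  have [z hz] := G_squeeze x0 xt eps2.
  have z0 : 0 <= z.
    have [e [hx _]] := filter_ex hz; apply: le_trans hx.
    by have /andP[] := df_ge0_le1 (mu e) (x * a e).
  have Lz : L c <= z.
    apply: L_le; split => //; exists x; split => //.
    by apply: filterS hz => e [].
  near=> e; have [_ h] : G e x <= z /\ z - eps / 2 <= G e t by near: e.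
  by lra.
near=> e; rewrite ler_distlC; apply/andP; split; first by rewrite lerBlDr -lerBlDr; near: e.
by near: e.
Unshelve. all: by end_near. Qed.

Lemma laplace_cvg_df : exists Ft : Rprobability R,
  [/\ on_half_line Ft, forall s, 0 <= s -> laplace Ft s = phi s &
      forall t, {for t, continuous (df Ft)} ->
        df (mu e) (t * a e) @[e --> F] --> df Ft t].
Proof.
have [Ft FtL] := probability_of_df L_homo L_rc L_Ny L_y.
have FtE : df Ft = L by apply/funext.
have hFt : on_half_line Ft.
  apply/(negligibleP Ft) => //.
  (* The distribution function controls closed half lines; the open one is exhausted by those ending
     at - 1 / (n + 1). *)
  apply: (@negligibleS _ _ _ Ft (\bigcup_n `]-oo, - n.+1%:R^-1]%classic)).
    move=> t /=; rewrite in_itv/= => t0; exists (Num.bound (- t)^-1) => //=.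
    have t'0 : 0 < - t by rewrite oppr_gt0.
    rewrite in_itv/= lerNr invf_ple ?posrE// ltW//.
    have : (- t)^-1 < (Num.bound (- t)^-1)%:R by apply: archi_boundP; rewrite invr_ge0 ltW.
    by move/lt_trans; apply; rewrite ltr_nat.
  apply: negligible_bigcup => n; apply/negligibleP => //.
  have n0 : - n.+1%:R^-1 < 0 :> R by rewrite oppr_lt0 invr_gt0.
  rewrite -[LHS]fineK ?fin_num_measure//; congr EFin.
  by have := FtL (- n.+1%:R^-1); rewrite L_lt0.
have cFt t : {for t, continuous (df Ft)} ->
    df (mu e) (t * a e) @[e --> F] --> df Ft t.
  by rewrite FtE; exact: G_cvg.
exists Ft; split => // s s0.
(* The direct half of the continuity theorem sends the same transforms to that of [Ft]; uniqueness
   of limits identifies it with [phi]. *)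
have h1 := df_cvg_laplace mu_half_line a_gt0 hFt cFt s0.
by rewrite -(cvg_lim _ (h1 _))// (cvg_lim _ (laplace_phi s0)).
Qed.

End laplace_inversion.

(** * Laplace transform of the hitting time *)

Lemma ge0_integral_mrestr d (T : measurableType d) (R : realType)
    (mu : {measure set T -> \bar R}) (X : set T) (mX : measurable X)
    (f : T -> \bar R) : measurable_fun setT f -> (forall x, 0 <= f x)%E ->
  (\int[mrestr mu mX]_x f x = \int[mu]_(x in X) f x)%E.
Proof.
move=> mf f0; rewrite -(setUv X) ge0_integral_setU//.
- rewrite [X in (_ + X)%E]null_set_integral ?adde0//.
  + by apply: eq_measure_integral => A mA AX; rewrite /= /mrestr setIidl.
  + exact: measurableC.
  + exact: measurable_funTS.
  + by rewrite /= /mrestr setICl measure0.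
- exact: measurableC.
- by rewrite setUv.
- by apply/disj_setPS; rewrite setICr.
Qed.

(** Bundles finiteness with the measure, so that product measures and Tonelli's theorem apply. *)
Lemma finite_measure_of_measure d (T : measurableType d) (R : realType)
    (mu : {measure set T -> \bar R}) : (mu setT < +oo)%E ->
  exists nu : {finite_measure set T -> \bar R}, forall A, nu A = mu A.
Proof.
move=> muT; exists (mfrestr measurableT muT) => A.
by rewrite /= /mfrestr /mrestr setIT.
Qed.

Lemma image_measure d d' (T : measurableType d) (T' : measurableType d')
    (R : realType) (mu : {measure set T -> \bar R}) (f : T -> T') :
  measurable_fun setT f -> exists nu : {measure set T' -> \bar R},
    (forall A, nu A = mu (f @^-1` A)) /\
    (forall g : T' -> \bar R, measurable_fun setT g -> (forall y, 0 <= g y)%E ->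
       \int[nu]_y g y = \int[mu]_x g (f x))%E.
Proof.
move=> mf; pose nu : {measure set T' -> \bar R} := pushforward mu f.
exists (nu mf); split => // g mg g0.
by rewrite ge0_integral_pushforward//= preimage_setT.
Qed.

(** On rectangles, the law of the pair [(S, K)] restricted to both [X] and [Y] is the product of the
    law of [S] restricted to [X] with [nu]. Uniqueness of the product measure extends this to all
    measurable sets, and Tonelli's theorem separates the integral. *)
Lemma ge0_integral_factor d (T : measurableType d) (R : realType)
    (P : {finite_measure set T -> \bar R}) (nu : Rmeasure R)
    (X Y : set T) (S K : T -> measurableTypeR R)
    (f g : measurableTypeR R -> \bar R) :
  measurable X -> measurable Y -> measurable_fun setT S -> measurable_fun setT K ->
  (nu setT < +oo)%E ->
  (forall B B', measurable B -> measurable B' ->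
    P (X `&` S @^-1` B `&` (Y `&` K @^-1` B')) = P (X `&` S @^-1` B) * nu B')%E ->
  measurable_fun setT f -> measurable_fun setT g ->
  (forall t, 0 <= f t)%E -> (forall t, 0 <= g t)%E ->
  (\int[P]_(w in X `&` Y) (f (S w) * g (K w)) =
   \int[P]_(w in X) f (S w) * \int[nu]_t g t)%E.
Proof.
move=> mX mY mS mK nu_fin PE mf mg f0 g0.
have mXY := measurableI _ _ mX mY.
have mSK : measurable_fun setT (fun w => (S w, K w)) by exact/measurable_fun_pairP.
have [n1 [n1E n1I]] := image_measure (mrestr P mX) mS.
have [m' [m'E m'I]] := image_measure (mrestr P mXY) mSK.
have n1_fin : (n1 setT < +oo)%E.
  by rewrite n1E preimage_setT ltey_eq fin_num_measure.
have [m1 m1E] := finite_measure_of_measure n1_fin.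
have [m2 m2E] := finite_measure_of_measure nu_fin.
have m12E A : measurable A -> (m1 \x m2)%E A = m' A.
  apply: product_measure_unique => B B' mB mB'.
  transitivity (n1 B * nu B')%E; last first.
    by congr (_ * _)%E; [exact/esym/m1E|exact/esym/m2E].
  rewrite n1E m'E /= /mrestr [in RHS]setIC -PE//.
  congr (P _); apply/seteqP; split => w /=; tauto.
pose h (z : measurableTypeR R * measurableTypeR R) := (f z.1 * g z.2)%E.
have mh : measurable_fun setT h.
  by apply: emeasurable_funM; apply: measurableT_comp.
have h0 z : (0 <= h z)%E by exact: mule_ge0.
have -> : (\int[P]_(w in X `&` Y) (f (S w) * g (K w)) = \int[m1 \x m2]_z h z)%E.
  rewrite (@eq_measure_integral _ _ _ _ m' _ h); last by move=> A mA _; exact: m12E.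
  by rewrite m'I// ge0_integral_mrestr//; exact: (measurableT_comp mh mSK).
rewrite fubini_tonelli1// /fubini_F /h /=.
under eq_integral do rewrite ge0_integralZl//.
rewrite ge0_integralZr//; last exact: integral_ge0.
congr (_ * _)%E; last by apply: eq_measure_integral => A mA _; exact: m2E.
rewrite (@eq_measure_integral _ _ _ _ n1 _ f); last by move=> A mA _; exact: m1E.
by rewrite n1I// ge0_integral_mrestr//; exact: measurableT_comp.
Qed.

Lemma eq_measure_half_lines (R : realType) (m1 m2 : Rmeasure R) :
  (m1 setT < +oo)%E -> (m2 setT < +oo)%E ->
  (forall t, m1 `]-oo, t]%classic = m2 `]-oo, t]%classic) ->
  forall B, measurable B -> m1 B = m2 B.
Proof.
move=> m1y m2y m12 B mB.
have fin (m : Rmeasure R) A : (m setT < +oo)%E -> measurable A -> m A \is a fin_num.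
  move=> my mA; rewrite ge0_fin_numE//; apply: le_lt_trans my.
  by apply: le_measure; rewrite ?inE.
apply: (@measure_unique _ _ (measurableTypeR R) (@ocitv R)
  (fun n => `](- n%:R), n%:R]%classic)) => //.
- exact: ocitvI.
- by move=> n; exact: is_ocitv.
- by rewrite bigcup_itvT.
- move=> _ [[a b] _ <-] /=.
  have [ab|ba] := leP a b; last first.
    by rewrite set_itv_ge ?measure0// bnd_simp -leNgt ltW.
  have -> : `]a, b]%classic = `]-oo, b] `\` `]-oo, a] :> set (measurableTypeR R).
    by rewrite -[RHS]setCK setCD setCitvl setUC -[LHS]setCK setCitv.
  rewrite !measureD//.
  + congr (_ - _)%E; first exact: m12.
    by rewrite setIidr; [exact: m12|exact: subset_itvl].
  + by rewrite -ge0_fin_numE//; exact: fin.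
  + by rewrite -ge0_fin_numE//; exact: fin.
- by move=> n; rewrite -ge0_fin_numE//; exact: fin.
Qed.

Lemma kernel_lty (R : realType) (M : nat) (Q : 'I_M -> 'I_M -> Rmeasure R) x y :
  semi_markov_kernel Q -> (Q x y setT < +oo)%E.
Proof.
move=> [_ Q1]; apply: (@le_lt_trans _ _ 1%E); last exact: ltry.
by rewrite -(Q1 x) (bigD1 y)//= leeDl// sume_ge0.
Qed.

(** * One step of the Markov renewal process *)

Section markov_renewal_step.
Context (R : realType) (M : nat) (d : measure_display) (T : measurableType d).
Context (P : probability T R) (eta : nat -> T -> 'I_M) (kappa : nat -> T -> R).
Context (Q : 'I_M -> 'I_M -> Rmeasure R).
Hypothesis mr : markov_renewal P eta kappa Q.

Let generators n : set (set T) := [set A | exists l : nat, (l <= n)%N /\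
  ((exists x, A = eta l @^-1` [set x]) \/
   (exists B : set (measurableTypeR R), measurable B /\ A = kappa l @^-1` B))].

Lemma history_measurable n A : history eta kappa n A -> measurable A.
Proof.
have [_ meta mkappa _ _] := mr.
apply: smallest_sub; first exact: sigma_algebra_measurable.
move=> B [l [_ [[x ->]|[C [mC ->]]]]]; first exact: meta.
by rewrite -[X in measurable X]setTI; exact: mkappa.
Qed.

(** Both sides are finite measures in [B], and the Markov property makes them agree on half
    lines. *)
Lemma markov_renewal_borel n A x y B : history eta kappa n A ->
  measurable (B : set (measurableTypeR R)) ->
  (P (A `&` [set w | eta n w = x] `&` [set w | eta n.+1 w = y /\ B (kappa n.+1 w)]) =
   P (A `&` [set w | eta n w = x]) * Q x y B)%E.
Proof.
move=> hA mB; have [_ meta mkappa _ step] := mr.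
have mA := history_measurable hA.
set X := A `&` [set w | eta n w = x].
have mX : measurable X by apply: measurableI => //; exact: meta.
have mY : measurable (X `&` [set w | eta n.+1 w = y]).
  by apply: measurableI => //; exact: meta.
have [m1 [m1E _]] := image_measure (mrestr P mY) (mkappa n.+1).
pose c : {nonneg R} := NngNum (fine_ge0 (measure_ge0 P X)).
have cE : c%:num%:E = P X by rewrite /= fineK ?fin_num_measure.
pose m2 : Rmeasure R := mscale c (Q x y).
have m2E C : m2 C = (P X * Q x y C)%E by rewrite -cE.
have m1E' C : m1 C = P (X `&` [set w | eta n.+1 w = y /\ C (kappa n.+1 w)]).
  by rewrite m1E /= /mrestr; congr (P _); apply/seteqP; split => w /=; tauto.
rewrite -m1E' -m2E; apply: eq_measure_half_lines => //.
- rewrite m1E /= /mrestr preimage_setT setTI ltey_eq fin_num_measure//.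
- by rewrite m2E lte_mul_pinfty// ?fin_num_measure//; apply: kernel_lty; case: mr.
- by move=> t; rewrite m1E' m2E -(step n A x y t hA); congr (P _);
    apply/seteqP; split => w /=; rewrite in_itv.
Qed.

Lemma kappa_sum_history n (B : set (measurableTypeR R)) : measurable B ->
  history eta kappa n [set w | B (\sum_(1 <= l < n.+1) kappa l w)].
Proof.
move=> mB; have [_ _ mkappa _ _] := mr.
(* The domain carries the sigma-algebra of the history instead of the ambient one, so that
   measurability of the sum yields an event of the history. *)
have mk l : (l <= n)%N ->
    measurable_fun setT (kappa l : g_sigma_algebraType (generators n) -> measurableTypeR R).
  move=> ln _ C mC; rewrite setTI; apply: sub_sigma_algebra.
  by exists l; split => //; right; exists C.
have mS : measurable_fun setT
    ((fun w => \sum_(1 <= l < n.+1) kappa l w) : g_sigma_algebraType (generators n) -> R).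
  under eq_fun do rewrite big_nat big_mkcond/=.
  apply: measurable_sum => l; have [/andP[_ ln]|_] := boolP (1 <= l < n.+1)%N.
    exact: mk.
  exact: measurable_cst.
by have := mS measurableT B mB; rewrite setTI.
Qed.

Lemma history_setI n A B : history eta kappa n A -> history eta kappa n B ->
  history eta kappa n (A `&` B).
Proof.
by move=> hA hB; exact: (@measurableI _ (g_sigma_algebraType (generators n)) A B hA hB).
Qed.

Lemma history_setC n A : history eta kappa n A -> history eta kappa n (~` A).
Proof.
by move=> hA; exact: (@measurableC _ (g_sigma_algebraType (generators n)) A hA).
Qed.

Lemma history_state n l x : (l <= n)%N -> history eta kappa n (eta l @^-1` [set x]).
Proof. by move=> ln; apply: sub_sigma_algebra; exists l; split => //; left; exists x. Qed.

(** The time elapsed up to step [n] belongs to the history, hence it factors from the next duration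
    on the event of a given transition. *)
Lemma laplace_step (s : R) n A x y : 0 <= s -> history eta kappa n A ->
  (\int[P]_(w in A `&` [set w | eta n w = x] `&` [set w | eta n.+1 w = y])
     (expR (- (s * \sum_(1 <= l < n.+2) kappa l w)))%:E =
   \int[P]_(w in A `&` [set w | eta n w = x])
     (expR (- (s * \sum_(1 <= l < n.+1) kappa l w)))%:E *
   \int[Q x y]_t (expR (- (s * t)))%:E)%E.
Proof.
move=> s0 hA; have [_ meta mkappa _ _] := mr.
have mA := history_measurable hA.
pose S w : measurableTypeR R := \sum_(1 <= l < n.+1) kappa l w.
have mS : measurable_fun setT S.
  by apply: measurable_sum => l; exact: mkappa.
pose f (t : measurableTypeR R) := (expR (- (s * t)))%:E.
have mf : measurable_fun setT f by apply/measurable_EFinP; exact: measurable_expRN.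
rewrite -(@ge0_integral_factor _ _ _ P (Q x y) (A `&` [set w | eta n w = x])
  [set w | eta n.+1 w = y] S (kappa n.+1) f f) //.
- apply: eq_integral => w _; have -> : \sum_(1 <= l < n.+2) kappa l w =
      \sum_(1 <= l < n.+1) kappa l w + kappa n.+1 w by rewrite big_nat_recr.
  by rewrite mulrDr opprD expRD EFinM.
- by apply: measurableI => //; exact: meta.
- exact: meta.
- by apply: kernel_lty; case: mr.
- move=> B B' mB mB'.
  have hAB : history eta kappa n (A `&` S @^-1` B).
    by apply: history_setI => //; exact: kappa_sum_history.
  rewrite [X in (P X * _)%E]setIAC -markov_renewal_borel//.
  by congr (P _); apply/seteqP; split => w /=; tauto.
- by move=> t; rewrite lee_fin expR_ge0.
- by move=> t; rewrite lee_fin expR_ge0.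
Qed.

End markov_renewal_step.

(** The pair (a n, b n) is the row vector (pi0, 0) times the n-th power of the 2x2 matrix of the
    q's, and the limit is Cramer's rule for the resolvent applied to the column (c, d). *)
Lemma two_state_series (R : realType) (a b : nat -> R)
    (pi0 qii qik qki qkk c d : R) :
  0 <= pi0 -> 0 <= qii < 1 -> 0 <= qkk < 1 -> 0 <= qik -> 0 <= qki ->
  qik * qki < (1 - qii) * (1 - qkk) ->
  a 0%N = pi0 -> b 0%N = 0 ->
  (forall n, a n.+1 = a n * qii + b n * qki) ->
  (forall n, b n.+1 = a n * qik + b n * qkk) ->
  \sum_(0 <= n < N) (a n * c + b n * d) @[N --> \oo] -->
  pi0 * (c * (1 - qkk) + qik * d) / ((1 - qii) * (1 - qkk) - qik * qki).
Proof.
move=> pi_ge0 /andP[ii0 ii1] /andP[kk0 kk1] ik0 ki0 det a0 b0 aS bS.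
have det0 : 0 < (1 - qii) * (1 - qkk) - qik * qki by rewrite subr_gt0.
have ab n : 0 <= a n /\ 0 <= b n.
  elim: n => [|n [an bn]]; first by rewrite a0 b0.
  by rewrite aS bS !addr_ge0 ?mulr_ge0.
pose A N := \sum_(0 <= n < N) a n; pose B N := \sum_(0 <= n < N) b n.
have AS N : A N.+1 = pi0 + A N * qii + B N * qki.
  rewrite /A big_nat_recl//= a0 -addrA; congr (_ + _).
  by rewrite /B !mulr_suml -big_split; apply: eq_bigr => n _; exact: aS.
have BS N : B N.+1 = A N * qik + B N * qkk.
  rewrite /B big_nat_recl//= b0 add0r.
  by rewrite /A !mulr_suml -big_split; apply: eq_bigr => n _; exact: bS.
have Aup N : A N <= A N.+1 by rewrite /A big_nat_recr//= lerDl; have [] := ab N.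
have Bup N : B N <= B N.+1 by rewrite /B big_nat_recr//= lerDl; have [] := ab N.
have A_ge0 N : 0 <= A N by apply: sumr_ge0 => n _; have [] := ab n.
(* Monotonicity turns the recursion of the partial sums into linear inequalities; eliminating [B N]
   leaves [A N] times the determinant, whose positivity gives the bound. *)
have Abnd N : A N <= pi0 * (1 - qkk) / ((1 - qii) * (1 - qkk) - qik * qki).
  rewrite ler_pdivlMr//; have := Aup N; have := Bup N; rewrite AS BS => h1 h2.
  have h3 : B N * (1 - qkk) <= A N * qik by lra.
  have h4 : A N * (1 - qii) <= pi0 + B N * qki by lra.
  have k1 : 0 <= 1 - qkk by lra.
  have := ler_wpM2r k1 h4; have := ler_wpM2r ki0 h3; lra.
have Bbnd N : B N <= pi0 * (1 - qkk) / ((1 - qii) * (1 - qkk) - qik * qki) * qik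
    / (1 - qkk).
  rewrite ler_pdivlMr ?subr_gt0//; have := Bup N; rewrite BS => h1.
  by apply: (@le_trans _ _ (A N * qik)); [lra|rewrite ler_wpM2r].
have cA : cvgn A.
  apply: nondecreasing_is_cvgn; first by apply/nondecreasing_seqP.
  by exists (pi0 * (1 - qkk) / ((1 - qii) * (1 - qkk) - qik * qki)) => _ [n _ <-].
have cB : cvgn B.
  apply: nondecreasing_is_cvgn; first by apply/nondecreasing_seqP.
  by eexists => _ [n _ <-]; exact: Bbnd.
pose al := limn A; pose bl := limn B.
have cAl : A @ \oo --> al by exact: cA.
have cBl : B @ \oo --> bl by exact: cB.
have Ae : al = pi0 + al * qii + bl * qki.
  apply: (@cvg_unique _ (@norm_hausdorff _ _) (A n.+1 @[n --> \oo])).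
    by have := cAl; rewrite -cvg_shiftS.
  rewrite (funext AS : (fun N => A N.+1) = _).
  by apply: cvgD; [apply: cvgD; [exact: cvg_cst|]|]; apply: cvgMr_tmp.
have Be : bl = al * qik + bl * qkk.
  apply: (@cvg_unique _ (@norm_hausdorff _ _) (B n.+1 @[n --> \oo])).
    by have := cBl; rewrite -cvg_shiftS.
  rewrite (funext BS : (fun N => B N.+1) = _).
  by apply: cvgD; apply: cvgMr_tmp.
have -> : pi0 * (c * (1 - qkk) + qik * d) / ((1 - qii) * (1 - qkk) - qik * qki) =
    al * c + bl * d.
  have alE : al * ((1 - qii) * (1 - qkk) - qik * qki) = pi0 * (1 - qkk).
    have h1 : bl * (1 - qkk) = al * qik by lra.
    have h2 : al * (1 - qii) = pi0 + bl * qki by lra.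
    have -> : al * ((1 - qii) * (1 - qkk) - qik * qki) =
      al * (1 - qii) * (1 - qkk) - al * qik * qki by ring.
    by rewrite h2 -h1; ring.
  have blE : bl * ((1 - qii) * (1 - qkk) - qik * qki) = pi0 * qik.
    have k0 : 1 - qkk != 0 by rewrite gt_eqF// subr_gt0.
    apply: (mulIf k0); rewrite mulrAC (_ : bl * (1 - qkk) = al * qik); last by lra.
    by rewrite mulrAC alE; ring.
  apply: (mulIf (lt0r_neq0 det0)); rewrite divfK ?gt_eqF//.
  by rewrite [RHS]mulrDl (mulrAC al) alE (mulrAC bl) blE; ring.
have -> : (fun N => \sum_(0 <= n < N) (a n * c + b n * d)) =
    (fun N => A N * c + B N * d).
  by apply/funext => N; rewrite big_split/= !mulr_suml.
by apply: cvgD; apply: cvgMr_tmp.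
Qed.

Section normalization.
Context (R : realType) (nu : Rmeasure R).
Hypotheses (nu_fin : (nu setT < +oo)%E) (nu_half_line : on_half_line nu).
Let mass := fine (nu setT).
Let nnu : Rprobability R := mnormalize nu (dirac (0 : measurableTypeR R)).

Lemma mnormalizeE A : measurable A -> nu A = (mass%:E * nnu A)%E.
Proof.
move=> mA; rewrite /nnu /= /mnormalize /mass.
have fT : nu setT \is a fin_num by rewrite ge0_fin_numE.
have [nu0|nu0] := eqVneq (nu setT) 0%E.
  rewrite nu0 /= mul0e; apply/eqP; rewrite eq_le measure_ge0 andbT -nu0.
  by apply: le_measure; rewrite ?inE.
case: ifPn => [/orP[//|/eqP h]|_]; first by rewrite h in fT.
by rewrite muleCA -EFinM mulfV ?mule1// fine_eq0.
Qed.

Lemma mnormalize_half_line : 0 < mass -> on_half_line nnu.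
Proof.
move=> m0; have := nu_half_line; rewrite /on_half_line mnormalizeE// => /eqP.
by rewrite mule_eq0 eqe gt_eqF//= => /eqP.
Qed.

Lemma mnormalize_laplace (s : R) : 0 <= s ->
  (\int[nu]_t (expR (- (s * t)))%:E = (mass * laplace nnu s)%:E)%E.
Proof.
move=> s0; pose H := (`[0%R, +oo[%classic : set (measurableTypeR R)).
have mH : measurable H by exact: measurable_itv.
have mf : measurable_fun setT (fun t : measurableTypeR R => (expR (- (s * t)))%:E).
  by apply/measurable_EFinP; exact: measurable_expRN.
rewrite -(setUv H) ge0_integral_setU//; last 3 first.
- exact: measurableC.
- by rewrite setUv.
- by apply/disj_setPS; rewrite setICr.
rewrite [X in (_ + X)%E]null_set_integral ?adde0; last 3 first.
- exact: measurableC.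
- exact: measurable_funTS.
- by rewrite setCitvr; exact: nu_half_line.
have mass0 : 0 <= mass by exact: fine_ge0.
pose c : {nonneg R} := NngNum mass0.
rewrite (@eq_measure_integral _ _ _ _ (mscale c nnu)); last first.
  by move=> A mA _; rewrite mnormalizeE.
rewrite ge0_integral_mscale//; last exact: measurable_funTS.
rewrite EFinM; congr (_ * _)%E; rewrite /laplace /Rintegral fineK//.
exact: (integrable_fin_num mH (expRN_integrable nnu s0)).
Qed.

End normalization.

Section kernel_laplace.
Context (R : realType) (M : nat) (Q : 'I_M -> 'I_M -> Rmeasure R).
Hypothesis hQ : semi_markov_kernel Q.

Lemma trans_prob_ge0 x y : 0 <= trans_prob Q x y.
Proof. exact: fine_ge0. Qed.

Lemma trans_prob_sum x : \sum_(y < M) trans_prob Q x y = 1.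
Proof.
have [_ Q1] := hQ; apply: EFin_inj; rewrite -(Q1 x) -sumEFin.
by apply: eq_bigr => y _; rewrite fineK// ge0_fin_numE// kernel_lty.
Qed.

Lemma sojourn_half_line x y : 0 < trans_prob Q x y -> on_half_line (sojourn Q x y).
Proof.
by have [hl _] := hQ; apply: mnormalize_half_line; [exact: kernel_lty|exact: hl].
Qed.

Lemma kernel_laplace x y (s : R) : 0 <= s ->
  (\int[Q x y]_t (expR (- (s * t)))%:E =
   (trans_prob Q x y * laplace (sojourn Q x y) s)%:E)%E.
Proof.
by have [hl _] := hQ; apply: mnormalize_laplace; [exact: kernel_lty|exact: hl].
Qed.

End kernel_laplace.

Lemma notin_pair (T : finType) (A : {set T}) (a b : T) :
  ~: A = [set a; b]%SET -> forall x, (x \notin A) = (x == a) || (x == b).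
Proof. by move=> hA x; rewrite -finset.in_setC hA !inE. Qed.

(** * Decomposition of the hitting event by the number of steps *)

Section hitting.
Context (R : realType) (M : nat) (d : measure_display) (T : measurableType d).
Context (P : probability T R) (eta : nat -> T -> 'I_M) (kappa : nat -> T -> R).
Context (Q : 'I_M -> 'I_M -> Rmeasure R) (D : {set 'I_M}) (i k : 'I_M).
Hypotheses (mr : markov_renewal P eta kappa Q) (ik : i != k).
Hypothesis hD : ~: D = [set i; k]%SET.

Let notinD := notin_pair hD.

Let S n w := \sum_(1 <= l < n.+1) kappa l w.

Let avoid n := [set w | eta 0 w = i /\ forall l, (1 <= l <= n)%N -> eta l w \notin D].

Let at_ n x := avoid n `&` [set w | eta n w = x].

Let next n y := avoid n `&` [set w | eta n.+1 w = y].

Let avoid_history n : history eta kappa n (avoid n).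
Proof.
have -> : avoid n = eta 0 @^-1` [set i] `&` \big[setI/setT]_(1 <= l < n.+1)
    (eta l @^-1` [set i] `|` eta l @^-1` [set k]).
  apply/seteqP; split => w /=.
    move=> [wi wD]; split => //; rewrite -bigcap_seq => l /=.
    rewrite mem_index_iota => ln; have := wD l ln; rewrite notinD.
    by move=> /orP[/eqP|/eqP]; [left|right].
  move=> [wi]; rewrite -bigcap_seq => wD; split => // l ln.
  have /= := wD l; rewrite mem_index_iota ltnS => /(_ ln).
  by rewrite notinD => -[->|->]; rewrite eqxx ?orbT.
apply: history_setI; first exact: history_state.
rewrite big_nat; apply: (big_ind (history eta kappa n)).
- rewrite -setC0 -(setICl (eta 0 @^-1` [set i])).
  apply: history_setC; apply: history_setI; last exact: history_state.
  by apply: history_setC; exact: history_state.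
- by move=> A B; exact: history_setI.
- move=> l /andP[_ ln]; rewrite -[X in _ X]setCK setCU.
  by apply: history_setC; apply: history_setI; apply: history_setC;
    exact: history_state.
Qed.

Let mS n : measurable_fun setT (S n : T -> measurableTypeR R).
Proof. by have [_ _ mk _ _] := mr; apply: measurable_sum => l; exact: mk. Qed.

Let m_at n x : measurable (at_ n x).
Proof.
have [_ meta _ _ _] := mr.
have ma := history_measurable mr (@avoid_history n).
by apply: measurableI => //; exact: meta.
Qed.

Let m_next n y : measurable (next n y).
Proof.
have [_ meta _ _ _] := mr.
have ma := history_measurable mr (@avoid_history n).
by apply: measurableI => //; exact: meta.
Qed.

Let avoid_state n w : avoid n w -> eta n w = i \/ eta n w = k.
Proof.
move=> [wi wD]; case: n wD => [|n] wD; first by left.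
by have := wD n.+1; rewrite leqnn => /(_ isT); rewrite notinD => /orP[] /eqP; [left|right].
Qed.

Let nextE n y : next n y =
  (at_ n i `&` [set w | eta n.+1 w = y]) `|` (at_ n k `&` [set w | eta n.+1 w = y]).
Proof.
apply/seteqP; split => w /=; last by move=> [[[? ?] ?]|[[? ?] ?]].
by move=> [aw wy]; have [|] := avoid_state aw; [left|right].
Qed.

(** This closes the recursion: a step that stays outside [D] prolongs an avoiding path, whereas a
    step into [D] ends it with a hit. *)
Let at_S n x : x \notin D -> at_ n.+1 x = next n x.
Proof.
move=> xD; apply/seteqP; split => w /= [[wi wD] wx]; split => //; split => // l.
  by move=> /andP[l1 ln]; apply: wD; rewrite l1 leqW.
move=> /andP[l1]; rewrite leq_eqVlt ltnS => /predU1P[->|ln]; first by rewrite wx.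
by apply: wD; rewrite l1.
Qed.

Let hit_indexP w m : hit_index eta D w = Some m <->
  [/\ (1 <= m)%N, eta m w \in D & forall l, (1 <= l < m)%N -> eta l w \notin D].
Proof.
rewrite /hit_index; case: pselect => [hit|nohit]; last first.
  by split => // -[m1 mD _]; exfalso; apply: nohit; exists m; rewrite m1.
case: ex_minnP => n /andP[n1 nD] nmin; split => [[<-]|[m1 mD mmin]].
  split => // l /andP[l1 ln]; apply/negP => lD.
  by have := nmin l; rewrite l1 lD => /(_ isT); rewrite leqNgt ln.
congr Some; apply/eqP; rewrite eqn_leq nmin ?m1//= leqNgt; apply/negP => nm.
by have := mmin n; rewrite n1 nm nD => /(_ isT).
Qed.

(** A hit at index [n.+1] is [n] steps outside [D] followed by a step to [j]; index 0 never counts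
    as a hit. *)
Let hit_event j t :
  [set w | (hit_time eta kappa D w <= t%:E)%E /\
     omap (eta^~ w) (hit_index eta D w) = Some j] `&` [set w | eta 0 w = i] =
  if j \in D then \bigcup_n (next n j `&` [set w | S n.+1 w <= t]) else set0.
Proof.
apply/seteqP; split => w /=.
  move=> [[+ +] wi]; rewrite /hit_time.
  case E : (hit_index eta D w) => [[|n]|] //=.
    by move/hit_indexP : E => [].
  move/hit_indexP : E => [_ nD nmin]; rewrite lee_fin => St [nj].
  by rewrite -nj nD; exists n => //; split => //; split.
case: ifPn => // jD [n _ [[[wi wD] nj] St]].
have E : hit_index eta D w = Some n.+1.
  by apply/hit_indexP; split => //; rewrite nj.
by split => //; rewrite /hit_time E /= nj lee_fin.
Qed.

Let next_trivIset j (A : nat -> set T) : j \in D ->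
  trivIset setT (fun n => next n j `&` A n).
Proof.
move=> jD; apply/trivIsetP => m n _ _.
wlog mn : m n / (m < n)%N => [th mn|_].
  have := mn; rewrite neq_ltn => /orP[|nm]; first by move/th; exact.
  by rewrite setIC; apply: th => //; rewrite eq_sym.
rewrite -subset0 => w [[[_ /= mj] _] [[[_ wD] _] _]].
by have := wD m.+1; rewrite mn mj jD => /(_ isT).
Qed.

(** The unnormalised law of the hitting time, on the event that the process starts at [i] and hits
    [D] at [j]. Built as a series over the number of steps, it has a series for transform. *)
Lemma hit_measure j : j \in D -> exists nu : Rmeasure R,
  [/\ forall t, nu `]-oo, t]%classic =
        P ([set w | (hit_time eta kappa D w <= t%:E)%E /\
             omap (eta^~ w) (hit_index eta D w) = Some j] `&`
           [set w | eta 0 w = i]),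
      on_half_line nu &
      forall s, (\int[nu]_t (expR (- (s * t)))%:E =
        \sum_(n <oo) \int[P]_(w in next n j) (expR (- (s * S n.+1 w)))%:E)%E].
Proof.
move=> jD; have [_ _ _ k0 _] := mr.
have /choice[m mP] n := image_measure (mrestr P (m_next n j)) (mS n.+1).
have mE n A : m n A = P (next n j `&` (S n.+1 @^-1` A)).
  by have [-> _] := mP n; rewrite /= /mrestr setIC.
exists (mseries m 0); split.
- move=> t; have mF n : measurable (next n j `&` [set w | S n.+1 w <= t]).
    apply: measurableI => //.
    have := @mS n.+1 measurableT _ (measurable_itv `]-oo, t]).
    by rewrite setTI; congr measurable; apply/seteqP; split => w /=; rewrite in_itv.
  rewrite hit_event jD measure_semi_bigcup//=; last 2 first.
  + exact: next_trivIset.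
  + exact: bigcup_measurable.
  apply: eq_eseriesr => n _; rewrite mE; congr (P _).
- transitivity (\sum_(n <oo) m n `]-oo, 0%R[%classic)%E => //.
  rewrite eseries0// => n _ _.
  rewrite mE (_ : next n j `&` _ = set0) ?measure0// -subset0 => w [_ /=].
  rewrite in_itv/= ltNge (_ : 0 <= S n.+1 w)//; exact: sumr_ge0.
- move=> s.
  have mf : measurable_fun setT (fun t : measurableTypeR R => (expR (- (s * t)))%:E).
    by apply/measurable_EFinP; exact: measurable_expRN.
  rewrite ge0_integral_measure_series//.
  apply: eq_eseriesr => n _; have [_ ->] := mP n => //.
  by rewrite ge0_integral_mrestr//; exact: (measurableT_comp mf (mS n.+1)).
Qed.

Section transform.
Variables (s : R) (s0 : 0 <= s).

Let h n x := (\int[P]_(w in at_ n x) (expR (- (s * S n w)))%:E)%E.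
Let g n y := (\int[P]_(w in next n y) (expR (- (s * S n.+1 w)))%:E)%E.
Let q x y := trans_prob Q x y * laplace (sojourn Q x y) s.

Let m_exp n : measurable_fun setT (fun w => (expR (- (s * S n w)))%:E).
Proof.
apply/measurable_EFinP.
exact: (measurableT_comp (measurable_expRN s) (mS n)).
Qed.

Let gE n y : g n y = (h n i * (q i y)%:E + h n k * (q k y)%:E)%E.
Proof.
have [hQ meta _ _ _] := mr.
rewrite /g nextE ge0_integral_setU//; last 4 first.
- by apply: measurableI => //; exact: meta.
- by apply: measurableI => //; exact: meta.
- exact: measurable_funTS.
- apply/disj_setPS => w [[[_ /= wi] _] [[_ /= wk] _]].
  by move: ik; rewrite -wi wk eqxx.
by rewrite /at_ !(laplace_step mr)// !kernel_laplace.
Qed.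

Let S_ge0 n w : 0 <= S n w.
Proof. by have [_ _ _ k0 _] := mr; apply: sumr_ge0. Qed.

Let h_fin n x : h n x \is a fin_num.
Proof.
rewrite ge0_fin_numE; last by apply: integral_ge0 => w _; rewrite lee_fin expR_ge0.
apply: (@le_lt_trans _ _ (\int[P]_(w in at_ n x) (cst 1 w))%E).
  apply: ge0_le_integral => //.
  - exact: measurable_funTS.
  - move=> w _; rewrite lee_fin.
    by have /andP[] := expRN_ge0_le1 (mulr_ge0 s0 (S_ge0 n w)).
by rewrite integral_cst// mul1e ltey_eq fin_num_measure.
Qed.

Let pTi := fine (P [set w | eta 0 w = i]).

Let h0i : h 0 i = pTi%:E.
Proof.
have [_ meta _ _ _] := mr.
have mi : measurable [set w | eta 0 w = i] by exact: meta.
rewrite /pTi fineK ?fin_num_measure// /h.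
have -> : at_ 0 i = [set w | eta 0 w = i].
  by apply/seteqP; split => w /=; [case|move=> wi; split => //; split => // -[]].
under eq_integral do rewrite /S big_geq// mulr0 oppr0 expR0.
by rewrite integral_cst// mul1e.
Qed.

Let h0k : h 0 k = 0%E.
Proof.
rewrite /h (_ : at_ 0 k = set0) ?integral_set0// -subset0 => w [[/= wi _] wk].
by move: ik; rewrite -wi wk eqxx.
Qed.

Let q_ge0_le x y : 0 <= q x y <= trans_prob Q x y.
Proof.
have [hQ _ _ _ _] := mr; rewrite /q.
have := trans_prob_ge0 Q x y; rewrite le_eqVlt => /predU1P[<-|p0].
  by rewrite mul0r lexx.
have /andP[l0 l1] := laplace_ge0_le1 (sojourn_half_line hQ p0) s0.
by rewrite mulr_ge0 ?ler_piMr// ltW.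
Qed.

Lemma hit_series j : trans_prob Q i i < 1 -> trans_prob Q k k < 1 ->
  trans_prob Q i k * trans_prob Q k i <
    (1 - trans_prob Q i i) * (1 - trans_prob Q k k) ->
  (\sum_(n <oo) g n j =
   (pTi * (q i j * (1 - q k k) + q i k * q k j) /
    ((1 - q i i) * (1 - q k k) - q i k * q k i))%:E)%E.
Proof.
move=> pii pkk det.
have iD : i \notin D by rewrite notinD eqxx.
have kD : k \notin D by rewrite notinD eqxx orbT.
have gR n y : g n y = (fine (h n i) * q i y + fine (h n k) * q k y)%:E.
  by rewrite gE -[h n i]fineK ?h_fin// -[h n k]fineK ?h_fin//.
have hS n y : y \notin D -> fine (h n.+1 y) =
    fine (h n i) * q i y + fine (h n k) * q k y.
  by move=> yD; rewrite /h at_S// -[X in fine X]/(g n y) gR.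
apply: cvg_lim => //.
rewrite (_ : (fun N => _) = EFin \o (fun N => \sum_(0 <= n < N)
    (fine (h n i) * q i j + fine (h n k) * q k j))); last first.
  by apply/funext => N /=; rewrite -sumEFin; apply: eq_bigr => n _; exact: gR.
apply: cvg_EFin; first by near=> N.
have /andP[ii0 ii1] := q_ge0_le i i; have /andP[kk0 kk1] := q_ge0_le k k.
have /andP[ik0 ik1] := q_ge0_le i k; have /andP[ki0 ki1] := q_ge0_le k i.
apply: (@two_state_series _ (fun n => fine (h n i)) (fun n => fine (h n k))) => //.
- exact: fine_ge0.
- by rewrite ii0 (le_lt_trans ii1).
- by rewrite kk0 (le_lt_trans kk1).
(* Each [q x y] lies between 0 and the transition probability, so the determinant condition passes
   from the probabilities to [q]. *)
- apply: (@le_lt_trans _ _ (trans_prob Q i k * trans_prob Q k i)).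
    exact: ler_pM.
  apply: (lt_le_trans det); apply: ler_pM; rewrite ?subr_ge0 ?(ltW pii) ?(ltW pkk)//.
    by rewrite lerD2l lerN2.
  by rewrite lerD2l lerN2.
- by rewrite h0i.
- by rewrite h0k.
- by move=> n; exact: hS.
- by move=> n; exact: hS.
Unshelve. all: by end_near. Qed.

End transform.

Lemma hit_laplace j : j \in D ->
  trans_prob Q i i < 1 -> trans_prob Q k k < 1 ->
  trans_prob Q i k * trans_prob Q k i <
    (1 - trans_prob Q i i) * (1 - trans_prob Q k k) ->
  exists nu : Rmeasure R,
  [/\ forall t, nu `]-oo, t]%classic =
        P ([set w | (hit_time eta kappa D w <= t%:E)%E /\
             omap (eta^~ w) (hit_index eta D w) = Some j] `&`
           [set w | eta 0 w = i]),
      on_half_line nu &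
      forall s, 0 <= s ->
        let q x y := trans_prob Q x y * laplace (sojourn Q x y) s in
        (\int[nu]_t (expR (- (s * t)))%:E =
         (fine (P [set w | eta 0 w = i]) * (q i j * (1 - q k k) + q i k * q k j) /
          ((1 - q i i) * (1 - q k k) - q i k * q k i))%:E)%E].
Proof.
move=> jD pii pkk det; have [nu [nu1 nu2 nu3]] := hit_measure jD.
by exists nu; split => // s s0 q; rewrite nu3 (hit_series s0).
Qed.

End hitting.

(** * Removal of virtual transitions and exclusion of a state *)

Section df_at_infinity.
Context (R : realType) (mu : Rprobability R).
(** The identity as a random variable on the line with law [mu]; its distribution function is
    [df mu]. *)
Let idTR : measurableTypeR R -> R := idfun.

#[local] HB.instance Definition _ :=
  @isMeasurableFun.Build _ _ _ _ idTR (@measurable_id _ _ setT).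

Lemma cvg_dfy1 : df mu t @[t --> +oo] --> (1 : R).
Proof. exact/fine_cvg/(@cvg_cdfy1 _ _ _ mu (idTR : {RV mu >-> R})). Qed.

End df_at_infinity.

Lemma df_mass_scale (R : realType) (mu : Rprobability R) (c k : R) : 0 < c ->
  df_mass (fun t => df mu (t * c) * k) = k.
Proof.
move=> c0; apply: cvg_lim => //; rewrite -[X in _ --> X]mul1r.
apply: cvgMr_tmp; apply: (cvg_comp (fun t => t * c) (df mu) _ (cvg_dfy1 mu)).
apply/cvgryPge => A; near=> t; rewrite -ler_pdivrMr//.
Unshelve. all: by end_near. Qed.

(** * Consequences of a chain leading into the target set *)

Section exit_from_chain.
Context (R : realType) (M : nat) (p : 'I_M -> 'I_M -> R) (D : {set 'I_M}).
Hypothesis p_ge0 : forall x y, 0 <= p x y.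

Let reaches (r : 'I_M) := exists (n : nat) (c : nat -> 'I_M),
  [/\ (1 <= n)%N, c 0%N = r, forall l, (1 <= l < n)%N -> c l \notin D,
      c n \in D & 0 < \prod_(1 <= l < n.+1) p (c l.-1) (c l)].

Let prod_step n (c : nat -> 'I_M) l :
  0 < \prod_(1 <= l < n.+1) p (c l.-1) (c l) -> (l < n)%N -> 0 < p (c l) (c l.+1).
Proof.
move=> prod0 ln; rewrite lt_neqAle p_ge0 andbT; apply/eqP => h.
have /eqP : \prod_(1 <= l < n.+1) p (c l.-1) (c l) = 0.
  apply/eqP; rewrite prodf_seq_eq0; apply/hasP; exists l.+1.
    by rewrite mem_index_iota.
  by rewrite /= -h.
by rewrite gt_eqF.
Qed.

(** If [r] were its own only possible successor, the chain would stay there and never enter [D]. *)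
Lemma reaches_leaves r : r \notin D -> reaches r -> exists2 j, j != r & 0 < p r j.
Proof.
move=> rD [n [c [n1 c0 cD cn prod0]]]; apply: contrapT => noexit.
have stay l : (l <= n)%N -> c l = r.
  elim: l => // l ih ln; apply: contrapT => /eqP cr; apply: noexit.
  by exists (c l.+1) => //; rewrite -{1}(ih (ltnW ln)); exact: prod_step prod0 _.
by move: cn; rewrite stay// (negbTE rD).
Qed.

Lemma reaches_last_step r : r \notin D -> reaches r ->
  exists x y, [/\ x \notin D, y \in D & 0 < p x y].
Proof.
move=> rD [n [c [n1 c0 cD cn prod0]]].
case: n n1 cD cn prod0 => // n _ cD cn prod0; exists (c n), (c n.+1); split => //.
  by case: n cD {cn prod0} => [|n] cD; [rewrite c0|apply: cD; rewrite ltnSn].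
exact: prod_step prod0 _.
Qed.

End exit_from_chain.

(** * Loop probabilities before and after exclusion of a state *)

Section two_transient_states.
Context (R : realType) (M : nat) (p : 'I_M -> 'I_M -> R) (D : {set 'I_M}).
Context (i k : 'I_M).
Hypotheses (ik : i != k) (hD : ~: D = [set i; k]%SET).
Hypotheses (p_ge0 : forall x y, 0 <= p x y) (p_sum : forall x, \sum_(y < M) p x y = 1).
Hypothesis leaves : forall r, r \notin D -> exists2 j, j != r & 0 < p r j.
Hypothesis exits : exists x y, [/\ x \notin D, y \in D & 0 < p x y].

Let pt := no_virtual p.

Let notinD := notin_pair hD.

Lemma loop_lt1 r : r \notin D -> p r r < 1.
Proof.
move=> /leaves[j jr pj]; rewrite -(p_sum r) (bigD1 r)//= ltrDl.
by rewrite (bigD1 j)//= ltr_pwDl// sumr_ge0.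
Qed.

Lemma no_virtual_ge0 r j : r \notin D -> 0 <= pt r j.
Proof.
move=> rD; rewrite /pt /no_virtual mulr_ge0// divr_ge0//.
by rewrite subr_ge0 ltW// loop_lt1.
Qed.

Lemma no_virtual_loop r : pt r r = 0.
Proof. by rewrite /pt /no_virtual eqxx mul0r. Qed.

Lemma no_virtualE r j : j != r -> pt r j = p r j / (1 - p r r).
Proof. by move=> jr; rewrite /pt /no_virtual jr mul1r. Qed.

Lemma no_virtual_gt0 r j : r \notin D -> (0 < pt r j) = (j != r) && (0 < p r j).
Proof.
move=> rD; rewrite /pt /no_virtual; case: eqVneq => [_|jr] /=.
  by rewrite mul0r ltxx.
by rewrite mul1r pmulr_lgt0// invr_gt0 subr_gt0 loop_lt1.
Qed.

Lemma no_virtual_sum r : r \notin D -> \sum_(j < M) pt r j = 1.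
Proof.
move=> rD; have l1 := loop_lt1 rD; have := p_sum r.
rewrite (bigD1 r)//= => /(canRL (addKr _)); rewrite addrC => h.
rewrite (bigD1 r)//= no_virtual_loop add0r.
under eq_bigr => j jr do rewrite (no_virtualE jr).
by rewrite -mulr_suml h mulfV// gt_eqF// subr_gt0.
Qed.

Lemma no_virtual_le1 r j : r \notin D -> pt r j <= 1.
Proof.
move=> rD; rewrite -(no_virtual_sum rD) (bigD1 j)//= lerDl sumr_ge0// => x _.
exact: no_virtual_ge0.
Qed.

Let iD : i \notin D. Proof. by rewrite notinD eqxx. Qed.
Let kD : k \notin D. Proof. by rewrite notinD eqxx orbT. Qed.

Lemma no_virtual_lt1 x y z : x \notin D -> y \in D -> 0 < p x y -> z \notin D ->
  pt x z < 1.
Proof.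
move=> xD yD pxy zD; rewrite -(no_virtual_sum xD) (bigD1 z)//= ltrDl.
have yz : y != z by apply: contraNneq zD => <-.
have yx : y != x by apply: contraNneq xD => <-.
rewrite (bigD1 y)//= ltr_pwDl ?no_virtual_gt0 ?yx// sumr_ge0// => w _.
exact: no_virtual_ge0.
Qed.

Lemma exclude_loop : exclude k pt i i = pt i k * pt k i.
Proof. by rewrite /exclude no_virtual_loop add0r. Qed.

Lemma exclude_loop_ge0_lt1 : 0 <= exclude k pt i i < 1.
Proof.
rewrite exclude_loop; have := no_virtual_ge0 k iD; have := no_virtual_ge0 i kD.
have := no_virtual_le1 k iD; have := no_virtual_le1 i kD.
have [x [y [xD yD pxy]]] := exits.
(* The last step of a chain into [D] starts at [i] or at [k]; from that state a transition to the
   other one is not certain. *)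
have : pt i k < 1 \/ pt k i < 1.
  move: (xD); rewrite notinD => /orP[] /eqP xE; [left|right].
    by rewrite -{1}xE (no_virtual_lt1 xD yD).
  by rewrite -{1}xE (no_virtual_lt1 xD yD).
move: (pt i k) (pt k i) => a b ab b1 a1 b0 a0.
by apply/andP; split; [nra|case: ab; nra].
Qed.

(** This is [exclude k pt i i < 1] cleared of its denominators. *)
Lemma two_state_det : p i k * p k i < (1 - p i i) * (1 - p k k).
Proof.
have /andP[_] := exclude_loop_ge0_lt1.
have i1 : 0 < 1 - p i i by rewrite subr_gt0 loop_lt1.
have k1 : 0 < 1 - p k k by rewrite subr_gt0 loop_lt1.
rewrite exclude_loop !no_virtualE//; last by rewrite eq_sym.
by rewrite mulrACA -invfM ltr_pdivrMr ?mulr_gt0// mul1r.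
Qed.

End two_transient_states.

(* [tab] and [Tab] are the probability and the transform of a transition a -> b
without virtual transitions, [kpib] and [Kib] those after exclusion of k. *)
Lemma two_state_solution (R : realType) (pii pik pij pki pkk pkj
    Lii Lik Lij Lki Lkk Lkj : R) :
  let tik := pik / (1 - pii) in let tij := pij / (1 - pii) in
  let tki := pki / (1 - pkk) in let tkj := pkj / (1 - pkk) in
  let Tik := (1 - pii) * Lik / (1 - pii * Lii) in
  let Tij := (1 - pii) * Lij / (1 - pii * Lii) in
  let Tki := (1 - pkk) * Lki / (1 - pkk * Lkk) in
  let Tkj := (1 - pkk) * Lkj / (1 - pkk * Lkk) in
  let kpii := tik * tki in let kpij := tij + tik * tkj in
  let Kij := Tij * (tij / kpij) + Tik * Tkj * (1 - tij / kpij) in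
  let Kii := Tik * Tki in
  1 - pii != 0 -> 1 - pkk != 0 -> 1 - pii * Lii != 0 -> 1 - pkk * Lkk != 0 ->
  1 - kpii != 0 -> kpij != 0 ->
  (1 - pii * Lii) * (1 - pkk * Lkk) - pik * Lik * (pki * Lki) != 0 ->
  (pij * Lij * (1 - pkk * Lkk) + pik * Lik * (pkj * Lkj)) /
    ((1 - pii * Lii) * (1 - pkk * Lkk) - pik * Lik * (pki * Lki)) =
  kpij / (1 - kpii) * ((1 - kpii) * Kij / (1 - kpii * Kii)).
Proof.
move=> tik tij tki tkj Tik Tij Tki Tkj kpii kpij Kij Kii.
move=> i1 k1 iL kL kpii1 kpij0 det.
have kpK : kpij * Kij = tij * Tij + tik * tkj * (Tik * Tkj).
  have -> : kpij * Kij = Tij * (kpij * (tij / kpij)) +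
     Tik * Tkj * (kpij - kpij * (tij / kpij)) by rewrite /Kij; ring.
  by rewrite (mulrC _ (tij / _)) divfK// {1}/kpij; ring.
have -> : kpij / (1 - kpii) * ((1 - kpii) * Kij / (1 - kpii * Kii)) =
    kpij * Kij / (1 - kpii * Kii).
  by rewrite mulrA (mulrA _ _ Kij) divfK.
have e1 : tij * Tij = pij * Lij / (1 - pii * Lii).
  by rewrite /tij /Tij; field; rewrite i1 iL.
have e2 : tik * Tik = pik * Lik / (1 - pii * Lii).
  by rewrite /tik /Tik; field; rewrite i1 iL.
have e3 : tki * Tki = pki * Lki / (1 - pkk * Lkk).
  by rewrite /tki /Tki; field; rewrite k1 kL.
have e4 : tkj * Tkj = pkj * Lkj / (1 - pkk * Lkk).
  by rewrite /tkj /Tkj; field; rewrite k1 kL.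
rewrite kpK (_ : tik * tkj * (Tik * Tkj) = tik * Tik * (tkj * Tkj)); last by ring.
rewrite /kpii /Kii (_ : tik * tki * (Tik * Tki) = tik * Tik * (tki * Tki)); last by ring.
rewrite e1 e2 e3 e4.
have -> : 1 - pik * Lik / (1 - pii * Lii) * (pki * Lki / (1 - pkk * Lkk)) =
  ((1 - pii * Lii) * (1 - pkk * Lkk) - pik * Lik * (pki * Lki)) /
  ((1 - pii * Lii) * (1 - pkk * Lkk)) by field; rewrite iL kL.
by field; rewrite iL kL det.
Qed.

(** * The hitting law for a fixed value of the parameter *)

Section hitting_distribution.
Context (R : realType) (M : nat) (d : measure_display) (T : measurableType d).
Context (P : probability T R) (eta : nat -> T -> 'I_M) (kappa : nat -> T -> R).
Context (Q : 'I_M -> 'I_M -> Rmeasure R) (D : {set 'I_M}) (i k j : 'I_M).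
Let p := trans_prob Q.
Let pt := no_virtual p.
Let kp := exclude k pt.
Hypotheses (mr : markov_renewal P eta kappa Q) (ik : i != k).
Hypotheses (hD : ~: D = [set i; k]%SET) (jD : j \in D).
Hypothesis start : (0 < P [set w | eta 0%N w = i])%E.
Hypothesis leaves : forall r, r \notin D -> exists2 j, j != r & 0 < p r j.
Hypothesis exits : exists x y, [/\ x \notin D, y \in D & 0 < p x y].

Let notinD := notin_pair hD.

Let iD : i \notin D. Proof. by rewrite notinD eqxx. Qed.
Let kD : k \notin D. Proof. by rewrite notinD eqxx orbT. Qed.
Let ij : j != i. Proof. by apply: contraNneq iD => <-. Qed.
Let kj : j != k. Proof. by apply: contraNneq kD => <-. Qed.

Let hQ : semi_markov_kernel Q. Proof. by case: mr. Qed.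
Let p_ge0 x y : 0 <= p x y. Proof. exact: trans_prob_ge0. Qed.
Let p_sum x : \sum_(y < M) p x y = 1. Proof. exact: trans_prob_sum. Qed.
Let i1 : 0 < 1 - p i i. Proof. by rewrite subr_gt0 (loop_lt1 p_ge0 p_sum leaves). Qed.
Let k1 : 0 < 1 - p k k. Proof. by rewrite subr_gt0 (loop_lt1 p_ge0 p_sum leaves). Qed.

Let L x y z := laplace (sojourn Q x y) z.
Let Tr x y z := (1 - p x x) * L x y z / (1 - p x x * L x x z).
(** The weight [pt i y / kp i y] is the conditional probability that a transition to [y] was direct
    and not through [k]. For [y = i] it is 0, as virtual transitions have been removed. *)
Let Kr y z := Tr i y z * (pt i y / kp i y) + Tr i k z * Tr k y z * (1 - pt i y / kp i y).

(** Bounding the product covers [p x y = 0], where the sojourn law is only a placeholder. *)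
Let pL_le x y z : 0 <= z -> 0 <= p x y * L x y z <= p x y.
Proof.
move=> z0; have := p_ge0 x y; rewrite le_eqVlt => /predU1P[<-|pxy].
  by rewrite mul0r lexx.
have /andP[l0 l1] := laplace_ge0_le1 (sojourn_half_line hQ pxy) z0.
by rewrite mulr_ge0 ?ler_piMr// ltW.
Qed.

Let pL0 x y : p x y * L x y 0 = p x y.
Proof.
have := p_ge0 x y; rewrite le_eqVlt => /predU1P[<-|pxy]; first by rewrite mul0r.
by rewrite /L (laplace0 (sojourn_half_line hQ pxy)) mulr1.
Qed.

Let det : p i k * p k i < (1 - p i i) * (1 - p k k).
Proof. exact: (two_state_det ik hD p_ge0 p_sum leaves exits). Qed.

Let kpE : kp i j = p i j / (1 - p i i) + p i k / (1 - p i i) * (p k j / (1 - p k k)).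
Proof. by rewrite /kp /exclude /pt !no_virtualE// eq_sym. Qed.

Let kp_loop : kp i i = p i k / (1 - p i i) * (p k i / (1 - p k k)).
Proof. by rewrite /kp exclude_loop /pt !no_virtualE// eq_sym. Qed.

Let Kr_loop z : Kr i z = Tr i k z * Tr k i z.
Proof. by rewrite /Kr /pt no_virtual_loop !mul0r mulr0 add0r subr0 mulr1. Qed.

Let kp_lt1 : 0 < 1 - kp i i.
Proof.
have /andP[_] := exclude_loop_ge0_lt1 hD p_ge0 p_sum leaves exits.
by rewrite subr_gt0.
Qed.

Let solution z : 0 <= z -> 0 < kp i j ->
  (p i j * L i j z * (1 - p k k * L k k z) + p i k * L i k z * (p k j * L k j z)) /
   ((1 - p i i * L i i z) * (1 - p k k * L k k z) - p i k * L i k z * (p k i * L k i z)) =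
  no_virtual kp i j * ((1 - kp i i) * Kr j z / (1 - kp i i * Kr i z)).
Proof.
move=> z0 kp0; rewrite (no_virtualE _ ij) Kr_loop /Kr /pt (no_virtualE _ ij).
rewrite kp_loop kpE.
have /andP[ii0 ii1] := pL_le i i z0; have /andP[kk0 kk1] := pL_le k k z0.
have /andP[ik0 ik1] := pL_le i k z0; have /andP[ki0 ki1] := pL_le k i z0.
have iL : 0 < 1 - p i i * L i i z by rewrite subr_gt0 (le_lt_trans ii1)// -subr_gt0.
have kL : 0 < 1 - p k k * L k k z by rewrite subr_gt0 (le_lt_trans kk1)// -subr_gt0.
apply: two_state_solution; rewrite ?gt_eqF//.
- by rewrite -kp_loop.
- by rewrite -kpE.
rewrite subr_gt0; apply: (@le_lt_trans _ _ (p i k * p k i)); first exact: ler_pM.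
apply: (lt_le_trans det); apply: ler_pM; rewrite ?(ltW i1) ?(ltW k1)//.
  by rewrite lerD2l lerN2.
by rewrite lerD2l lerN2.
Qed.

Lemma hit_df_laplace :
  (kp i j = 0 -> forall t, hit_df P eta kappa D i j t = 0) /\
  (0 < kp i j -> exists mu : Rprobability R,
    [/\ on_half_line mu,
        forall t, hit_df P eta kappa D i j t = df mu t * no_virtual kp i j &
        forall z, 0 <= z ->
          laplace mu z = (1 - kp i i) * Kr j z / (1 - kp i i * Kr i z)]).
Proof.
have [_ meta _ _ _] := mr.
have mi : measurable [set w | eta 0%N w = i] by exact: meta.
set pi0 := fine (P [set w | eta 0%N w = i]).
have pi_gt0 : 0 < pi0 by rewrite fine_gt0// start ltey_eq fin_num_measure.
have ii1 : p i i < 1 by rewrite -subr_gt0.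
have kk1 : p k k < 1 by rewrite -subr_gt0.
have [nu [nuE nu_hl nuL]] := hit_laplace mr ik hD jD ii1 kk1 det.
have nuL' z : 0 <= z -> (\int[nu]_t (expR (- (z * t)))%:E =
    (pi0 * (p i j * L i j z * (1 - p k k * L k k z) +
            p i k * L i k z * (p k j * L k j z)) /
     ((1 - p i i * L i i z) * (1 - p k k * L k k z) -
      p i k * L i k z * (p k i * L k i z)))%:E)%E by exact: nuL.
(* The total mass is the transform at 0, where each duration contributes a factor 1. *)
have nuT : nu setT = (pi0 * (p i j * (1 - p k k) + p i k * p k j) /
    ((1 - p i i) * (1 - p k k) - p i k * p k i))%:E.
  have := nuL' 0 (lexx 0); rewrite !pL0 => <-.
  under eq_integral do rewrite mul0r oppr0 expR0.
  by rewrite integral_cst// mul1e.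
have nu_fin : (nu setT < +oo)%E by rewrite nuT ltry.
have hitE t : hit_df P eta kappa D i j t = fine (nu `]-oo, t]%classic) / pi0.
  by rewrite /hit_df /cond_prob nuE.
split=> [kp0 t|kp_gt0].
  have /andP[pij0 pikj0] : (p i j == 0) && (p i k * p k j == 0).
    have : 0 <= p i j / (1 - p i i) by rewrite divr_ge0// ltW.
    have : 0 <= p i k / (1 - p i i) * (p k j / (1 - p k k)).
      by rewrite mulr_ge0// divr_ge0// ltW.
    move=> h1 h2; move: kp0 => /eqP; rewrite kpE paddr_eq0//.
    by rewrite !mulf_eq0 !invr_eq0 (gt_eqF i1) (gt_eqF k1) !orbF.
  rewrite hitE (_ : nu _ = 0%E) ?mul0r//; apply/eqP; rewrite eq_le measure_ge0 andbT.
  rewrite (@le_trans _ _ (nu setT))//; first by apply: le_measure; rewrite ?inE.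
  by rewrite nuT (eqP pij0) (eqP pikj0) mul0r addr0 mulr0 mul0r.
have kpt0 : 0 < no_virtual kp i j by rewrite (no_virtualE _ ij) divr_gt0.
(* The determinant is [1 - kp i i] times [(1 - p i i) * (1 - p k k)], so the mass is [pi0] times the
   probability that [i] exits to [j] once [k] is excluded and loops are removed. *)
have massE : fine (nu setT) = pi0 * no_virtual kp i j.
  rewrite nuT /= -mulrA; congr (_ * _).
  have det0 : 0 < (1 - p i i) * (1 - p k k) - p i k * p k i by rewrite subr_gt0.
  have kE : 1 - kp i i = ((1 - p i i) * (1 - p k k) - p i k * p k i) /
      ((1 - p i i) * (1 - p k k)).
    by rewrite kp_loop; field; rewrite (gt_eqF i1) (gt_eqF k1).
  rewrite (no_virtualE _ ij) kE kpE; field.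
  by rewrite (gt_eqF i1) (gt_eqF k1) (gt_eqF det0).
have mass0 : 0 < fine (nu setT) by rewrite massE mulr_gt0.
exists (mnormalize nu (dirac (0 : measurableTypeR R))); split.
- exact: mnormalize_half_line.
- move=> t; rewrite hitE (mnormalizeE nu_fin)// fineM// ?fin_num_measure//.
  by rewrite [fine _%:E]massE mulrAC (mulrC pi0) mulfK ?gt_eqF// mulrC.
- move=> z z0; have := nuL' z z0; rewrite (mnormalize_laplace nu_fin nu_hl z0).
  rewrite massE => -[]; rewrite -mulrA -[in X in _ = X -> _]mulrA.
  move=> /(mulfI (lt0r_neq0 pi_gt0)).
  by rewrite solution// => /(mulfI (lt0r_neq0 kpt0)).
Qed.

End hitting_distribution.

(** * Passage to the limit *)

Theorem theorem2 (R : realType) (M : nat) (D : {set 'I_M}) (i k : 'I_M)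
    (d : measure_display) (T : R -> measurableType d)
    (P : forall e : R, probability (T e) R)
    (eta : forall e : R, nat -> T e -> 'I_M)
    (kappa : forall e : R, nat -> T e -> R)
    (Q : R -> 'I_M -> 'I_M -> Rmeasure R)
    (v : R -> 'I_M -> R) (v0 : 'I_M -> \bar R)
    (p0 pt0 : 'I_M -> 'I_M -> R) (F0 : 'I_M -> 'I_M -> Rprobability R)
    (kpt0 q0 : 'I_M -> R) (w0 : R)
    (p := fun e => trans_prob (Q e))
    (pt := fun e => no_virtual (p e))
    (kp := fun e => exclude k (pt e))
    (kpt := fun e => no_virtual (kp e))
    (vt := fun e r => (1 - p e r r)^-1 * v e r)
    (kvt := fun e => (1 - kp e i i)^-1 * (1 - p e i i)^-1 * v e i)
    (hD0 : D != finset.set0) (hik : i != k) (hD : ~: D = [set i; k]%SET)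
    (hmrp : forall e, 0 < e <= 1 -> markov_renewal (P e) (eta e) (kappa e) (Q e))
    (hstart : forall e, 0 < e <= 1 -> (0 < P e [set w | eta e 0%N w = i])%E)
    (hv : forall e r, 0 < e <= 1 -> r \notin D -> 1 <= v e r)
    (hA : forall e r, 0 < e <= 1 -> \sum_(j < M) df (Q e r j) 0 < 1)
    (hB1 : forall r j, r \notin D ->
       (forall e, 0 < e <= 1 -> 0 < p e r j) \/
       (forall e, 0 < e <= 1 -> p e r j = 0))
    (hB2 : forall r, r \notin D ->
       exists (n : nat) (c : nat -> 'I_M),
         [/\ (1 <= n)%N, c 0%N = r,
             forall l, (1 <= l < n)%N -> c l \notin D,
             c n \in D &
             0 < \prod_(1 <= l < n.+1) p 1 (c l.-1) (c l)])
    (hC : forall r j, r \notin D -> p e r j @[e --> 0^'+] --> p0 r j)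
    (hD1 : forall r j, r \notin D -> j \in targets (p 1) r ->
       [/\ on_half_line (F0 r j), df (F0 r j) 0 < 1 &
           weak_cvg (fun e t => df (sojourn (Q e) r j) (t * v e r))
                    (df (F0 r j))])
    (hD2 : forall r, r \notin D ->
       (1 <= v0 r)%E /\ (v e r)%:E @[e --> 0^'+] --> v0 r)
    (hE : forall r j, r \notin D -> j \in targets (p 1) r ->
       [/\ forall e, 0 < e <= 1 -> (mean (sojourn (Q e) r j) < +oo)%E,
           (mean (F0 r j) < +oo)%E &
           fine (mean (sojourn (Q e) r j)) / v e r @[e --> 0^'+]
             --> fine (mean (F0 r j))])
    (hCt : forall r j, r \notin D ->
       0 <= pt0 r j <= 1 /\ pt e r j @[e --> 0^'+] --> pt0 r j)
    (hkCt : forall j, j != k ->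
       0 <= kpt0 j <= 1 /\ kpt e i j @[e --> 0^'+] --> kpt0 j)
    (hkCh : forall j, j \in ktargets (p 1) i k ->
       0 <= q0 j <= 1 /\ pt e i j / kp e i j @[e --> 0^'+] --> q0 j)
    (hkFh : 0 <= w0 /\ vt e k / vt e i @[e --> 0^'+] --> w0) :
  forall j, j \in D ->
    let G := fun e t => hit_df (P e) (eta e) (kappa e) D i j (t * kvt e) in
    (j \in ktargets_t (p 1) i k ->
       exists Ft : Rprobability R,
         [/\ on_half_line Ft,
             forall s, 0 <= s ->
               laplace Ft s = kphit0 (p 1) p0 F0 i k pt0 q0 w0 j s &
             weak_cvg G (fun t => df Ft t * kpt0 j)]) /\
    (j \notin ktargets_t (p 1) i k -> weak_cvg G (fun=> 0)).
Proof.
have near01 : \forall e \near (0 : R)^'+, 0 < e <= 1.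
  near=> e; apply/andP; split; near: e; first exact: nbhs_right_gt.
  exact: nbhs_right_le.
have one01 : 0 < (1 : R) <= 1 by rewrite ltr01 lexx.
have notinD := notin_pair hD.
have iD : i \notin D by rewrite notinD eqxx.
have kD : k \notin D by rewrite notinD eqxx orbT.
have hQ e : 0 < e <= 1 -> semi_markov_kernel (Q e) by move=> /hmrp[].
have p_ge0 e x y : 0 <= p e x y by exact: trans_prob_ge0.
have p_sum e x : 0 < e <= 1 -> \sum_(y < M) p e x y = 1.
  by move=> e01; apply: trans_prob_sum; exact: hQ.
(* Supports do not depend on [e], so the case distinctions of the limit formulas, made at 1, are
   valid for every [e]. *)
have p_gt0 e r j : 0 < e <= 1 -> r \notin D ->
    (0 < p e r j) = (j \in targets (p 1) r).
  move=> e01 rD; rewrite inE; have [h|h] := hB1 r j rD; first by rewrite !h.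
  by rewrite !h.
have leaves e : 0 < e <= 1 ->
    forall r, r \notin D -> exists2 j, j != r & 0 < p e r j.
  move=> e01 r rD; have [j jr pj] := reaches_leaves (p_ge0 1) rD (hB2 r rD).
  by exists j => //; rewrite p_gt0// inE.
have exits e : 0 < e <= 1 -> exists x y, [/\ x \notin D, y \in D & 0 < p e x y].
  move=> e01; have [x [y [xD yD pxy]]] := reaches_last_step (p_ge0 1) iD (hB2 i iD).
  by exists x, y; split => //; rewrite p_gt0// inE.
have loop01 e r : 0 < e <= 1 -> r \notin D -> 0 <= p e r r < 1.
  move=> e01 rD; rewrite p_ge0/=.
  exact: (loop_lt1 (p_ge0 e) (fun x => p_sum e x e01) (leaves e e01)).
have pt_ge0 e r j : 0 < e <= 1 -> r \notin D -> 0 <= pt e r j.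
  move=> e01 rD.
  exact: (no_virtual_ge0 (p_ge0 e) (fun x => p_sum e x e01) (leaves e e01)).
have pt_gt0 e r j : 0 < e <= 1 -> r \notin D ->
    (0 < pt e r j) = (j \in targets_t (p 1) r).
  move=> e01 rD; rewrite in_setD1 -(p_gt0 e)//.
  exact: (no_virtual_gt0 (p_ge0 e) (fun x => p_sum e x e01) (leaves e e01)).
have kpE e j : kp e i j = pt e i j + pt e i k * pt e k j by [].
have kp_gt0E e j : 0 < e <= 1 -> (0 < kp e i j) =
    (j \in targets_t (p 1) i) || ((k \in targets_t (p 1) i) && (j \in targets_t (p 1) k)).
  move=> e01; rewrite -!(pt_gt0 e)// kpE.
  have := pt_ge0 e i j e01 iD; have := pt_ge0 e i k e01 iD.
  have := pt_ge0 e k j e01 kD.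
  move: (pt e i j) (pt e i k) (pt e k j) => x y z z0 y0 x0.
  have [x1|] := ltP 0 x; first by rewrite ltr_pwDl// mulr_ge0.
  rewrite le_eqVlt ltNge x0 orbF => /eqP ->; rewrite add0r /=.
  have [y1|] := ltP 0 y; first by rewrite pmulr_rgt0.
  by rewrite le_eqVlt ltNge y0 orbF => /eqP ->; rewrite mul0r ltxx.
have kp_gt0 e j : 0 < e <= 1 -> j != k ->
    (0 < kp e i j) = (j \in ktargets (p 1) i k).
  by move=> e01 jk; rewrite in_setD1 jk /= inE -/(kp 1 i j) !kp_gt0E.
have kp_loop01 e : 0 < e <= 1 -> 0 <= kp e i i < 1.
  move=> e01; exact: (exclude_loop_ge0_lt1 hD (p_ge0 e) (fun x => p_sum e x e01)
    (leaves e e01) (exits e e01)).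
have v_gt0 e r : 0 < e <= 1 -> r \notin D -> 0 < v e r.
  by move=> e01 rD; apply: lt_le_trans (hv e r e01 rD).
pose phi r j e s := laplace (sojourn (Q e) r j) (s / v e r).
have base r j : r \notin D -> j \in targets (p 1) r ->
    cvg_family (0 : R)^'+ (phi r j) (laplace (F0 r j)) (fine (mean (F0 r j))).
  move=> rD jr; have [hl _ [wc _]] := hD1 r j rD jr.
  have [m1 m2 m3] := hE r j rD jr.
  apply: cvg_family_laplace => //.
  - near=> e; have e01 : 0 < e <= 1 by near: e.
    by apply: sojourn_half_line; [exact: hQ|rewrite -/(p e r j) p_gt0].
  - by near=> e; apply: v_gt0 => //; near: e.
  - by near=> e; apply: m1; near: e.
(* The factor [1 - p e r r] in the argument reflects the change of unit from [v e r] to [vt e r]. *)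
pose Tf r j e s := (1 - p e r r) * phi r j e ((1 - p e r r) * s) /
  (1 - p e r r * phi r r e ((1 - p e r r) * s)).
have cvgT r j : r \notin D -> j \in targets_t (p 1) r ->
    cvg_family (0 : R)^'+ (Tf r j) (phit0 (p 1) p0 F0 r j) (et0 (p 1) p0 F0 r j).
  move=> rD; rewrite in_setD1 => /andP[jr jt].
  rewrite /phit0 /et0; have [rt|rt] /= := boolP (r \in targets (p 1) r).
    apply: cvg_family_no_virtual; [|exact: hC|exact: base|exact: base].
    by near=> e; apply: loop01 => //; near: e.
  apply: eq_cvg_family (base r j rD jt) => //.
  near=> e => s s0; have e01 : 0 < e <= 1 by near: e.
  have pr0 : p e r r = 0.
    by apply/eqP; rewrite eq_le p_ge0 andbT leNgt p_gt0.
  by rewrite /Tf pr0 subr0 !mul1r mul0r subr0 divr1.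
have w_ge0 : \forall e \near (0 : R)^'+, 0 <= vt e k / vt e i.
  near=> e; have e01 : 0 < e <= 1 by near: e.
  have /andP[_ i1] := loop01 e i e01 iD; have /andP[_ k1] := loop01 e k e01 kD.
  by rewrite divr_ge0// mulr_ge0 ?invr_ge0 ?subr_ge0 ?(ltW i1) ?(ltW k1)// ltW// v_gt0.
have [w0_ge0 cvg_w] := hkFh.
pose Kf j e s := Tf i j e s * (pt e i j / kp e i j) +
  Tf i k e s * Tf k j e (vt e k / vt e i * s) * (1 - pt e i j / kp e i j).
have cvgTT j : k \in targets_t (p 1) i -> j \in targets_t (p 1) k ->
    cvg_family (0 : R)^'+ (fun e s => Tf i k e s * Tf k j e (vt e k / vt e i * s))
      (fun s => phit0 (p 1) p0 F0 i k s * phit0 (p 1) p0 F0 k j (w0 * s))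
      (et0 (p 1) p0 F0 i k + w0 * et0 (p 1) p0 F0 k j).
  move=> ki jk; apply: cvg_family_mul; first exact: cvgT.
  by apply: cvg_family_scale => //; exact: cvgT.
(* The moment is kept explicit: at [j = i] it is [ke0], which enters the limit if the loop created
   at [i] gets limiting probability 1. *)
have cvgK_new j : j != k -> j \in ktargets (p 1) i k -> j \notin targets_t (p 1) i ->
    cvg_family (0 : R)^'+ (Kf j) (kphi0 (p 1) p0 F0 i k q0 w0 j)
      (et0 (p 1) p0 F0 i k + w0 * et0 (p 1) p0 F0 k j).
  move=> jk jt ji.
  have /andP[ki jk'] : (k \in targets_t (p 1) i) && (j \in targets_t (p 1) k).
    by move: jt; rewrite -(kp_gt0 1)// kp_gt0E// (negbTE ji).
  apply: eq_cvg_family (cvgTT j ki jk').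
    near=> e => s s0; have e01 : 0 < e <= 1 by near: e.
    have pt0' : pt e i j = 0.
      by apply/eqP; rewrite eq_le pt_ge0// andbT leNgt pt_gt0.
    by rewrite /Kf pt0' mul0r mulr0 add0r subr0 mulr1.
  by move=> s _; rewrite /kphi0 (negbTE ji).
(* For the exit to [j] the existence of a moment is enough: its value does not occur in the limit
   transform and only serves to bound it from below. *)
have cvgK j : j != k -> j \in ktargets (p 1) i k -> exists m,
    cvg_family (0 : R)^'+ (Kf j) (kphi0 (p 1) p0 F0 i k q0 w0 j) m.
  move=> jk jt; have [ji|ji] := boolP (j \in targets_t (p 1) i); last first.
    by eexists; exact: cvgK_new.
  have [/andP[ki jk']|nki] :=
      boolP ((k \in targets_t (p 1) i) && (j \in targets_t (p 1) k)).
    have [q01 cvg_q] := hkCh j jt.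
    eexists; apply: eq_cvg_family (cvg_family_mix _ cvg_q q01 (cvgT i j iD ji)
      (cvgTT j ki jk')).
    + by near=> e.
    + by move=> s _; rewrite /kphi0 ji ki jk'.
    + near=> e; have e01 : 0 < e <= 1 by near: e.
      have kp0 : 0 < kp e i j by rewrite kp_gt0.
      rewrite divr_ge0 ?pt_ge0 ?(ltW kp0)//= ler_pdivrMr// mul1r kpE lerDl.
      by rewrite mulr_ge0// pt_ge0.
  eexists; apply: eq_cvg_family (cvgT i j iD ji).
    near=> e => s s0; have e01 : 0 < e <= 1 by near: e.
    have pij : 0 < pt e i j by rewrite pt_gt0.
    have kpt' : kp e i j = pt e i j.
      rewrite kpE [X in _ + X](_ : _ = 0) ?addr0//.
      apply/eqP; rewrite mulf_eq0; move: nki; rewrite negb_and.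
      by rewrite -!(pt_gt0 e)// -!leNgt => /orP[] h;
        apply/orP; [left|right]; rewrite eq_le h pt_ge0.
    by rewrite /Kf kpt' divff ?gt_eqF// mulr1 subrr mulr0 addr0.
  by move=> s _; rewrite /kphi0 ji (negbTE nki).
have kp_cvg : kp e i i @[e --> (0 : R)^'+] --> exclude k pt0 i i.
  rewrite /kp /exclude.
  have [_ h1] := hCt i i iD; have [_ h2] := hCt i k iD; have [_ h3] := hCt k i kD.
  by apply: cvgD => //; exact: cvgM.
pose Ff j e s := (1 - kp e i i) * Kf j e ((1 - kp e i i) * s) /
  (1 - kp e i i * Kf i e ((1 - kp e i i) * s)).
have cvgF j : j \in ktargets_t (p 1) i k -> exists m, cvg_family (0 : R)^'+ (Ff j)
    (kphit0 (p 1) p0 F0 i k pt0 q0 w0 j) m.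
  rewrite in_setD1 => /andP[ji jt].
  have jk : j != k by move: jt; rewrite in_setD1 => /andP[].
  have [m hm] := cvgK j jk jt.
  rewrite /kphit0; have [it|it] /= := boolP (i \in ktargets (p 1) i k).
    eexists; apply: cvg_family_no_virtual; [|exact: kp_cvg| |exact: hm].
      by near=> e; apply: kp_loop01; near: e.
    by apply: cvgK_new => //; rewrite in_setD1 eqxx.
  exists m; apply: eq_cvg_family hm => //.
  near=> e => s s0; have e01 : 0 < e <= 1 by near: e.
  have kp0 : kp e i i = 0.
    apply/eqP; rewrite eq_le; have /andP[-> _] := kp_loop01 e e01.
    by rewrite andbT leNgt kp_gt0.
  by rewrite /Ff kp0 subr0 !mul1r mul0r subr0 divr1.
have kvt_gt0 e : 0 < e <= 1 -> 0 < kvt e.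
  move=> e01; have /andP[_ h1] := kp_loop01 e e01; have /andP[_ h2] := loop01 e i e01 iD.
  by rewrite !mulr_gt0 ?invr_gt0 ?subr_gt0// v_gt0.
move=> j jD G.
have ji : j != i by apply: contraNneq iD => <-.
have jk : j != k by apply: contraNneq kD => <-.
have hit e : 0 < e <= 1 -> _ := fun e01 => hit_df_laplace (hmrp e e01) hik hD jD
  (hstart e e01) (leaves e e01) (exits e e01).
split=> [jt|jt]; last first.
  have G0 e : 0 < e <= 1 -> G e = fun=> 0.
    move=> e01; apply/funext => t; have [+ _] := hit e e01; apply.
    apply/eqP; rewrite eq_le leNgt -[exclude _ _ _ _]/(kp e i j) kp_gt0//.
    move: jt; rewrite in_setD1 ji /= => ->.
    by rewrite /= kpE; apply: addr_ge0; [|apply: mulr_ge0]; exact: pt_ge0.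
  split.
    move=> t _; apply: cvg_near_cst; near=> e.
    by rewrite G0//; near: e.
  apply: cvg_near_cst; near=> e.
  by rewrite G0//; near: e.
have jkt : j \in ktargets (p 1) i k by move: jt; rewrite in_setD1 => /andP[].
(* Outside ]0, 1] a Dirac mass is chosen as default; only small positive [e] matter for the
   limit. *)
have /choice[mu muP] e : exists mu : Rprobability R, 0 < e <= 1 ->
    [/\ on_half_line mu, forall t, G e t = df mu (t * kvt e) * kpt e i j &
        forall s, 0 <= s -> laplace mu (s / kvt e) = Ff j e s].
  have [e01|ne01] := pselect (0 < e <= 1); last first.
    by exists (dirac (0 : measurableTypeR R)) => /ne01.
  have kp0 : 0 < kp e i j by rewrite kp_gt0.
  have [_ /(_ kp0) [nu [h1 h2 h3]]] := hit e e01.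
  exists nu => _; split => // [t|s s0]; first exact: h2.
  have /andP[_ i1] := loop01 e i e01 iD; have /andP[_ k1] := loop01 e k e01 kD.
  have /andP[_ kp1] := kp_loop01 e e01.
  have vi := v_gt0 e i e01 iD; have vk := v_gt0 e k e01 kD.
  (* All nested rescalings collapse to a single division by [kvt e]; for [k], the ratio
     [vt e k / vt e i] converts one unit of time into the other. *)
  have argi : (1 - p e i i) * ((1 - kp e i i) * s) / v e i = s / kvt e.
    by rewrite /kvt; field; rewrite !subr_eq0 !gt_eqF.
  have argk : (1 - p e k k) * (vt e k / vt e i * ((1 - kp e i i) * s)) / v e k =
      s / kvt e.
    by rewrite /kvt /vt; field; rewrite !subr_eq0 !gt_eqF.
  rewrite h3; last by rewrite divr_ge0// ltW// kvt_gt0.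
  by rewrite /Ff /Kf /Tf /phi argi argk.
have [m hm] := cvgF j jt.
have [_ _ _ [_ lower]] := hm.
have [Ft [Ft1 Ft2 Ft3]] : exists Ft : Rprobability R, [/\ on_half_line Ft,
    forall s, 0 <= s -> laplace Ft s = kphit0 (p 1) p0 F0 i k pt0 q0 w0 j s &
    forall t, {for t, continuous (df Ft)} ->
      df (mu e) (t * kvt e) @[e --> 0^'+] --> df Ft t].
  (* The moment [m] plays the role of the constant [C]: the bound [1 - m * s] makes the limit law
     proper. *)
  apply: (@laplace_cvg_df _ _ (0 : R)^'+ _ mu kvt _ m).
  - near=> e; have e01 : 0 < e <= 1 by near: e.
    by have [] := muP e e01.
  - by near=> e; apply: kvt_gt0; near: e.
  - move=> s s0; apply: cvg_trans (cvg_family_at hm s0); apply: near_eq_cvg.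
    near=> e; have e01 : 0 < e <= 1 by near: e.
    by have [_ _ ->] := muP e e01.
  - by move=> s s0; have [] := lower s s0.
exists Ft; split => //.
have [/andP[kpt0_ge0 _] cvg_kpt] := hkCt j jk.
split.
- move=> t ct.
  apply: (@cvg_trans _ (df (mu e) (t * kvt e) * kpt e i j @[e --> 0^'+])).
    apply: near_eq_cvg; near=> e; have e01 : 0 < e <= 1 by near: e.
    by have [_ -> _] := muP e e01.
  (* Continuity of the product at [t] passes to [df Ft] by division by [kpt0 j]. When [kpt0 j = 0]
     it tells nothing about [df Ft], and the values are squeezed between 0 and [kpt e i j]
     instead. *)
  have [kpt0_eq0|kpt0_neq0] := eqVneq (kpt0 j) 0; last first.
    apply: cvgM => //; apply: Ft3.
    rewrite (_ : df Ft = fun t => df Ft t * kpt0 j / kpt0 j); last first.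
      by apply/funext => u; rewrite mulfK.
    by apply: cvgMr_tmp.
  rewrite kpt0_eq0 mulr0; rewrite kpt0_eq0 in cvg_kpt.
  apply: (@squeeze_cvgr _ _ _ _ (fun=> 0) (fun e => kpt e i j)) => //.
    near=> e; have e01 : 0 < e <= 1 by near: e.
    have /andP[d0 d1] := df_ge0_le1 (mu e) (t * kvt e).
    have kpt_ge0 : 0 <= kpt e i j.
      have kp0 : 0 < kp e i j by rewrite kp_gt0.
      have /andP[_ kp1] := kp_loop01 e e01.
      by rewrite /kpt no_virtualE// divr_ge0 ?subr_ge0 ?(ltW kp0) ?(ltW kp1).
    by rewrite mulr_ge0//= ler_piMl.
  exact: cvg_cst.
- have -> : df_mass (fun t => df Ft t * kpt0 j) = kpt0 j.
    have := @df_mass_scale _ Ft 1 (kpt0 j) ltr01.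
    by under eq_fun do rewrite mulr1.
  apply: cvg_trans cvg_kpt; apply: near_eq_cvg; near=> e.
  have e01 : 0 < e <= 1 by near: e.
  have [_ Ge _] := muP e e01.
  by rewrite (_ : G e = fun t => df (mu e) (t * kvt e) * kpt e i j);
    [rewrite df_mass_scale// kvt_gt0|apply/funext].
Unshelve. all: by end_near. Qed.
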